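(* Let $n \geq 1$. The algebraic multiplicity $m_n$ of the eigenvalue $1$ of $R_n^*$ satisfies $m_n = n - k_n$, where the sequence $(k_n)$ is defined by $k_1=0$ and $k_n = \max(k_{n-1}, \omega(n)+1)$ for $n\ge 2$. In particular, $$n - \left\lfloor \frac{1.3841\,\log n}{\log\log n}\right\rfloor - 1 \leq m_n \quad (n\ge 3), \qquad m_n \leq n - \left\lfloor \frac{\log n}{\log\log n}\right\rfloor \quad (n \geq 6).$$ Moreover, for every $n\ge 3$, $$\left| m_n - n + \frac{\log n}{\log\log n}\right| \leq \frac{2\log n}{(\log\log n)^2}.$$
   Context: $\omega(m)$ denotes the number of distinct prime factors of $m$. For positive integers $i,j$, $i \parallel j$ means $i \mid j$ and $\gcd(i,j/i)=1$. $R_n^*=(\rho_{ij})_{1\le i,j\le n}$ is the $n\times n$ matrix with $\rho_{ij}=1$ if $i \parallel j$ or $j=1$, and $\rho_{ij}=0$ otherwise. The algebraic multiplicity of the eigenvalue $1$ is its multiplicity as a root of the characteristic polynomial $\det(\lambda I_n - R_n^* )$. *)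

(* Defs.v *)
From mathcomp Require Import all_boot all_order all_algebra.
From mathcomp Require Import all_classical all_reals all_analysis.
Set Implicit Arguments. Unset Strict Implicit. Unset Printing Implicit Defensive.
Import Order.TTheory GRing.Theory Num.Theory.

Definition omega (m : nat) : nat := size (primes m).

Definition udvd (i j : nat) : bool := (i %| j) && coprime i (j %/ i).

(* R_n^* as an n x n rational matrix; row/column index i : 'I_n stands for i+1 *)
Definition Rstar (n : nat) : 'M[rat]_n :=
  \matrix_(i < n, j < n)
    (if udvd i.+1 j.+1 || (j.+1 == 1)%N then 1 else 0)%R.

Definition mult1 (n : nat) : nat := mup (1 : rat) (char_poly (Rstar n)).

(* k_1 = 0, k_n = max(k_{n-1}, omega n + 1) for n >= 2 (k_0 := 0 is unused) *)
Fixpoint kseq (n : nat) : nat :=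
  match n with
  | 0 => 0
  | 1 => 0
  | S m => maxn (kseq m) (omega n + 1)
  end.

(* Main.v *)
Require Import Defs.
From Stdlib Require BinNat Nnat.
From mathcomp Require Import all_boot all_order all_algebra.
From mathcomp Require Import all_classical all_reals all_analysis.
From mathcomp Require Import zify ring lra.
Import Order.TTheory GRing.Theory Num.Theory.
Local Open Scope ring_scope.

(** Let [N] be the strictly upper triangular matrix of proper unitary
    divisibility and [v = (0, 1, ..., 1)], so that the matrix is
    [1 + N + v e_1^T].  Writing [t = X - 1], a column operation gives
    [t^(K+1) chi = t^n (t^(K+1) - sum_(k <= K) c_k t^(K-k))], where
    [c_k = (N^k v)_1] counts the chains of [k] proper unitary divisors starting
    at [1].  If [K] is the largest value of [omega] on [1..n], then
    [N^(K+1) v = 0] and [c_K > 0], whence the multiplicity is [n - K - 1].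

    Moreover [K = pi(x)] for the [x] with [P(x) <= n < P(x+1)], where [P(x)] is
    the product of the primes up to [x].  With [theta = ln P], each estimate is
    an induction on [x] in which only the passage from [L = theta(p-1)] to
    [L + ln p] at a prime [p] matters: the bound on [L / ln L] from above needs
    just [p <= e theta(p-1)], and the bounds from below need Chebyshev's
    [theta(x) <= x ln 4] together with a numerical start. *)

(** * Characteristic polynomial of a unitriangular matrix with a modified first column *)

(** With [T = t - N], the combination [w] of the iterates [N^k v] telescopes: [T w = t^(K+1) v].
    Corrected by a multiple of [e0] it becomes [x], which [t - N - v e0^T] maps to a multiple of
    [e0]; putting [x] in the first column of [C] therefore makes the product upper triangular. *)
Lemma char_poly_border (F : idomainType) n (N : 'M[F]_n.+1) (v : 'cV[F]_n.+1) K :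
    (forall i j : 'I_n.+1, (j <= i)%N -> N i j = 0) ->
    N ^+ K.+1 *m v = 0 ->
  ('X - 1) ^+ K.+1 * char_poly (1%:M + N + v *m delta_mx 0 0) =
  ('X - 1) ^+ n.+1 * (('X - 1) ^+ K.+1 -
     \sum_(k < K.+1) ((N ^+ k *m v) 0 0)%:P * ('X - 1) ^+ (K - k)).
Proof.
move=> Nup NKv; set t : {poly F} := 'X - 1.
pose c (k : nat) : 'cV[{poly F}]_n.+1 := map_mx polyC (N ^+ k *m v).
pose N' : 'M[{poly F}]_n.+1 := map_mx polyC N.
pose T := t%:M - N'.
pose e0 : 'cV[{poly F}]_n.+1 := delta_mx 0 0.
have cS k : N' *m c k = c k.+1 by rewrite -map_mxM mulmxA /c exprS.
pose w := \sum_(k < K.+1) t ^+ (K - k) *: c k.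
have Tw : T *m w = t ^+ K.+1 *: c 0%N.
  suff H m : (m <= K)%N ->
      T *m (\sum_(k < m.+1) t ^+ (K - k) *: c k) =
      t ^+ K.+1 *: c 0%N - t ^+ (K - m) *: c m.+1.
    rewrite H // (_ : c K.+1 = 0) ?scaler0 ?subr0 //.
    by rewrite /c NKv map_mx0.
  elim: m => [|m IH] mK.
    rewrite big_ord_recl big_ord0 addr0 -scalemxAr mulmxBl cS mul_scalar_mx.
    by rewrite scalerBr scalerA subn0 -exprSr.
  rewrite big_ord_recr /= mulmxDr IH ?(ltnW mK) // -scalemxAr mulmxBl cS.
  rewrite mul_scalar_mx scalerBr scalerA -exprSr -subSn // subSS.
  by rewrite addrA subrK.
have Te0 : T *m e0 = t *: e0.
  apply/matrixP => i j; rewrite ord1 -colE !mxE /= Nup // subr0.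
  by rewrite eqxx andbT mulr_natr.
(* The multiple of [e0] is chosen so that [x 0 0 = t^(K+1)]: the border column then cancels
   [T w]. *)
pose x := w + (t ^+ K.+1 - w 0 0) *: e0.
have x00 : x 0 0 = t ^+ K.+1 by rewrite !mxE !eqxx mulr1 addrC subrK.
pose B := char_poly_mx (1%:M + N + v *m delta_mx 0 0).
have BE : B = T - c 0%N *m delta_mx 0 0.
  rewrite /B /char_poly_mx !map_mxD map_scalar_mx map_mxM map_delta_mx.
  rewrite /c expr0 mul1mx /T opprD addrA; congr (_ - _).
  by rewrite opprD addrA; congr (_ - _); rewrite -raddfB.
pose s := t * (t ^+ K.+1 - w 0 0).
have Bx : B *m x = s *: e0.
  rewrite BE mulmxBl {1}/x mulmxDr Tw -scalemxAr Te0 scalerA [_ * t]mulrC.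
  rewrite -mulmxA -rowE (_ : row 0 x = (t ^+ K.+1)%:M); last first.
    by apply/matrixP => i j; rewrite !ord1 [LHS]mxE [RHS]mxE x00.
  by rewrite mul_mx_scalar addrAC subrr add0r.
pose C : 'M[{poly F}]_n.+1 :=
  \matrix_(i, j) if j == 0 then x i 0 else (i == j)%:R.
have BC i j : (B *m C) i j = if j == 0 then s *+ (i == 0) else B i j.
  rewrite mxE; case: eqP => [->|/eqP j0].
    rewrite -[LHS](_ : (B *m x) i 0 = _).
      by rewrite Bx !mxE eqxx andbT mulr_natr.
    by rewrite mxE; apply: eq_bigr => k _; rewrite [C _ _]mxE eqxx.
  rewrite (bigD1 j) //= [C _ _]mxE (negbTE j0) eqxx mulr1 big1 ?addr0 // => k kj.
  by rewrite [C _ _]mxE (negbTE j0) (negbTE kj) mulr0.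
have detC : \det C = t ^+ K.+1.
  rewrite det_trig; last first.
    apply/is_trig_mxP => i j ij; rewrite mxE -!val_eqE /=.
    by case: eqP => [j0|_]; [rewrite j0 in ij | rewrite (ltn_eqF ij)].
  rewrite big_ord_recl mxE eqxx x00 big1 ?mulr1 // => i _.
  by rewrite mxE eqxx.
have detBC : \det (B *m C) = s * t ^+ n.
  rewrite -det_tr det_trig; last first.
    apply/is_trig_mxP => i j ij; rewrite mxE BC.
    case: eqP => [i0|/eqP i0].
      by rewrite -val_eqE /= gtn_eqF //; rewrite i0 in ij.
    rewrite BE !mxE big_ord_recl big_ord0 !mxE eqxx /= (negbTE i0) mulr0 addr0.
    rewrite Nup ?(ltnW ij) // -[j == i]val_eqE /= gtn_eqF //.
    by rewrite mulr0n !subr0.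
  rewrite big_ord_recl mxE BC !eqxx mulr1n; congr (_ * _).
  rewrite -[X in _ ^+ X]card_ord -prodr_const; apply: eq_bigr => i _.
  rewrite mxE BC /= BE !mxE big_ord_recl big_ord0 !mxE /= mulr0 addr0.
  by rewrite Nup // eqxx mulr1n !subr0.
have := det_mulmx B C; rewrite detBC detC => E.
rewrite mulrC -[char_poly _]/(\det B) -E.
rewrite /s mulrAC -exprS; congr (_ * (_ - _)).
rewrite /w summxE; apply: eq_bigr => k _.
by rewrite 2!mxE mulrC.
Qed.

(** * Unitary divisors and the number of prime factors *)

Lemma omegaM m n : (0 < m)%N -> (0 < n)%N -> coprime m n ->
  omega (m * n) = (omega m + omega n)%N.
Proof.
move=> m0 n0 cmn; rewrite /omega -size_cat; apply: perm_size.
apply: uniq_perm; first exact: primes_uniq.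
  by rewrite cat_uniq !primes_uniq andbT /= -coprime_has_primes.
by move=> p; rewrite primesM // mem_cat.
Qed.

Lemma omega_gt0 m : (1 < m)%N -> (0 < omega m)%N.
Proof.
move=> m1; have : pdiv m \in primes m.
  by rewrite mem_primes pdiv_prime // (ltnW m1) pdiv_dvd.
by rewrite /omega; case: (primes m).
Qed.

(** The cofactor [j %/ i] exceeds 1 and is coprime to [i], so it brings a new prime. This bounds the
    length of chains of proper unitary divisors. *)
Lemma udvd_omega_ltn i j : (0 < j)%N -> udvd i j -> i != j -> (omega i < omega j)%N.
Proof.
move=> j0 /andP[ij cij] neq.
have i0 : (0 < i)%N by exact: dvdn_gt0 ij.
have q0 : (0 < j %/ i)%N by rewrite divn_gt0 // dvdn_leq.
rewrite -[in ltnRHS](divnK ij) mulnC omegaM // -addn1 leq_add2l omega_gt0 //.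
rewrite ltn_neqAle q0 andbT eq_sym; apply: contraNneq neq => q1.
by rewrite -[j](divnK ij) q1 mul1n.
Qed.

(* Multiplying [i] by the full [p]-part of [j] adds exactly one prime. *)
Lemma udvd_step i j : (0 < j)%N -> udvd i j -> i != j ->
  exists k, [/\ udvd i k, udvd k j, i != k & omega k = (omega i).+1].
Proof.
move=> j0 /andP[ij cij] neq.
have i0 : (0 < i)%N by exact: dvdn_gt0 ij.
set q := (j %/ i)%N in cij *; have jE : j = (i * q)%N by rewrite mulnC divnK.
have q0 : (0 < q)%N by rewrite divn_gt0 // dvdn_leq.
have q1 : (1 < q)%N.
  rewrite ltn_neqAle q0 andbT eq_sym; apply: contraNneq neq => q1.
  by rewrite jE q1 muln1.
pose p := pdiv q; have pp : prime p by exact: pdiv_prime.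
pose a := (q`_p)%N; pose b := (q`_p^')%N.
have abE : (a * b = q)%N by exact: partnC.
have a0 : (0 < a)%N by exact: part_gt0.
have b0 : (0 < b)%N by exact: part_gt0.
have cab : coprime a b by exact: coprime_partC.
move: cij; rewrite -abE coprimeMr => /andP[cia cib].
have omega_a : omega a = 1%N.
  rewrite /omega /a p_part primesX ?primes_prime //.
  by rewrite logn_gt0 mem_primes pp q0 pdiv_dvd.
exists (i * a)%N; split.
- by rewrite /udvd dvdn_mulr // mulKn.
- rewrite /udvd jE -abE mulnA dvdn_mulr // mulKn ?muln_gt0 ?i0 //.
  by rewrite coprimeMl cib.
- apply/eqP => E; have : omega i = omega (i * a) by rewrite -E.
  by rewrite omegaM // omega_a; lia.
- by rewrite omegaM // omega_a addn1.
Qed.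

(** * The running maximum of [omega] *)

Lemma kseqSS n : kseq n.+2 = maxn (kseq n.+1) (omega n.+2).+1.
Proof. by rewrite -[(omega _).+1]addn1. Qed.

(** Together with [kseq_omega_ex], this identifies [kseq n] as one more than the maximum of [omega]
    on [[1..n]]. The case [n = 1] is an exception, since [kseq 1] is 0. *)
Lemma kseq_omega_ltn n m : (1 < n)%N -> (m <= n)%N -> (omega m < kseq n)%N.
Proof.
elim: n => // [[|n] IH] // _; rewrite kseqSS leq_max => mn.
have [->|neq] := eqVneq m n.+2; first by rewrite leqnn orbT.
have {neq}mn1 : (m <= n.+1)%N by lia.
case: n => [|n] in IH mn mn1 *; last by rewrite IH.
by case: m {IH} mn mn1 => [|[|m]].
Qed.

Lemma kseq_omega_ex n : (1 < n)%N ->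
  exists m, [/\ (1 < m)%N, (m <= n)%N & kseq n = (omega m).+1].
Proof.
elim: n => // [[|n] IH] // _; rewrite kseqSS.
have [le|lt] := leqP (kseq n.+1) (omega n.+2).+1; first by exists n.+2.
case: n => [|n] in IH lt *; first by [].
have [//|m [m1 mn E]] := IH; exists m; rewrite m1 (leq_trans mn) //.
Qed.

Lemma omega_ltn m : (0 < m)%N -> (omega m < m)%N.
Proof.
move=> m0; suff : (size (primes m) <= size (iota 2 m.-1))%N by rewrite size_iota /omega; lia.
apply: uniq_leq_size; first exact: primes_uniq.
move=> p; rewrite mem_primes mem_iota => /and3P[/prime_gt1 -> _ /(dvdn_leq m0)].
by lia.
Qed.

(** Ensures that the subtraction [n - kseq n] is never truncated. *)
Lemma kseq_leq n : (kseq n <= n)%N.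
Proof.
case: n => [|[|n]] //; have [//|m [m1 mn ->]] := kseq_omega_ex n.+2.
by apply: leq_trans mn; rewrite omega_ltn // ltnW.
Qed.

(** * The multiplicity of the eigenvalue 1 *)

Section UnitaryDivisorMatrix.
Variable n : nat.

Let N : 'M[rat]_n.+1 := \matrix_(i, j) ((udvd i.+1 j.+1) && (i != j))%:R.
Let v : 'cV[rat]_n.+1 := \col_i (i != 0)%:R.
(** Entry [i] counts the chains of [k] proper unitary divisibilities that start at [i + 1] and end
    at a number other than 1. *)
Let c k : 'cV[rat]_n.+1 := N ^+ k *m v.

Let cS k i : c k.+1 i 0 = \sum_j N i j * c k j 0.
Proof. by rewrite /c exprS -mulmxA mxE. Qed.

Lemma Rstar_border : Rstar n.+1 = 1%:M + N + v *m delta_mx 0 0.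
Proof.
apply/matrixP => i j; rewrite !mxE big_ord_recl big_ord0 !mxE eqxx addr0 /=.
have udvd_refl k : udvd k.+1 k.+1 by rewrite /udvd dvdnn divnn coprimen1.
have [->|ij] := eqVneq i j; first rewrite udvd_refl /= addr0.
  by case: (eqVneq j 0) => _ /=; rewrite ?mulr0 ?mul0r addr0.
rewrite andbT add0r eqSS; case: (eqVneq j 0) => [j0|j0] /=.
  have i0 : i != 0 by rewrite -j0.
  rewrite j0 /= orbT mulr1 i0 /udvd dvdn1 eqSS -[0%N]/(val (0 : 'I_n.+1)).
  by rewrite val_eqE (negbTE i0) /= add0r.
rewrite -[0%N]/(val (0 : 'I_n.+1)) val_eqE (negbTE j0) orbF mulr0 addr0.
by case: udvd.
Qed.

Let N_upper (i j : 'I_n.+1) : (j <= i)%N -> N i j = 0.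
Proof.
move=> ji; rewrite mxE; case: eqVneq => [->|ij] /=; first by rewrite andbF.
rewrite andbT /udvd; case: dvdnP => // -[k E]; move: ij; rewrite -val_eqE /=.
by case: k E => [|[|k]]; lia.
Qed.

Let c_ge0 k i : 0 <= c k i 0.
Proof.
elim: k i => [|k IH] i; first by rewrite /c expr0 mul1mx mxE ler0n.
by rewrite cS sumr_ge0 // => j _; rewrite mulr_ge0 // mxE ler0n.
Qed.

(** Each step of a chain raises [omega], so [k] steps from [i + 1] would reach a number with at
    least [k] more prime factors. *)
Let c_eq0 k (i : 'I_n.+1) : (forall j : 'I_n.+1, omega j.+1 < omega i.+1 + k)%N -> c k i 0 = 0.
Proof.
elim: k i => [|k IH] i H; first by have := H i; rewrite addn0 ltnn.
rewrite cS big1 // => j _; rewrite mxE.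
case: (boolP (_ && _)) => [/andP[ij neq]|_]; last by rewrite mul0r.
have lt := @udvd_omega_ltn _ _ (isT : (0 < j.+1)%N) ij neq.
by rewrite IH ?mulr0 // => l; apply: leq_trans (H l) _; lia.
Qed.

(** [udvd_step] climbs from [i + 1] to [j + 1] one prime at a time; this single chain makes a sum of
    nonnegative terms positive. *)
Let c_gt0 k (i j : 'I_n.+1) : udvd i.+1 j.+1 -> j != 0 ->
  omega j.+1 = (omega i.+1 + k)%N -> 0 < c k i 0.
Proof.
move=> ij j0; elim: k i ij => [|k IH] i ij om.
  have E : i = j.
    apply/eqP; apply/negPn/negP => neq.
    by have := @udvd_omega_ltn _ _ (isT : (0 < j.+1)%N) ij neq; lia.
  by rewrite /c expr0 mul1mx mxE E j0.
have neq : i.+1 != j.+1 by apply/eqP => E; move: om; rewrite E; lia.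
have [l [il lj nil oml]] := @udvd_step _ _ (isT : (0 < j.+1)%N) ij neq.
have l0 : (0 < l)%N by case/andP: lj => /dvdn_gt0 ->.
have ln : (l.-1 < n.+1)%N.
  case/andP: lj => /(dvdn_leq (isT : (0 < j.+1)%N)); have := ltn_ord j; lia.
have lE : (Ordinal ln).+1 = l by rewrite /= prednK.
rewrite cS (bigD1 (Ordinal ln)) //= ltr_pwDl //.
  rewrite mulr_gt0 ?IH ?lE // ?mxE ?lE; last by rewrite om oml addSnnS.
  by rewrite il -val_eqE /= -eqSS prednK // nil ltr01.
by rewrite sumr_ge0 // => m _; rewrite mulr_ge0 // mxE ler0n.
Qed.

Lemma mult1S : mult1 n.+1 = (n.+1 - kseq n.+1)%N.
Proof.
rewrite /mult1.
have [->|n0] := posnP n.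
  (* The 1 x 1 case is separate because [kseq 1 = 0]: the characteristic polynomial is [X - 1]. *)
  rewrite subn0 /char_poly /char_poly_mx det_mx11 !mxE /= mulr1n.
  by rewrite -[_ - _]expr1 mup_XsubCX eqxx.
have n1 : (1 < n.+1)%N by [].
have [m [m1 mn kE]] := kseq_omega_ex _ n1.
have le_om := kseq_omega_ltn _ _ n1.
set K := omega m in kE.
have om1 : omega 1 = 0%N by [].
have NKv : N ^+ K.+1 *m v = 0.
  apply/matrixP => i j; rewrite ord1 [RHS]mxE; apply: c_eq0 => l.
  by have := le_om l.+1 (ltn_ord l); rewrite kE; lia.
have mp : (m.-1 < n.+1)%N by lia.
have cK : 0 < c K 0 0.
  apply: (c_gt0 K 0 (Ordinal mp)).
  - by rewrite /udvd dvd1n coprime1n.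
  - by rewrite -val_eqE /=; lia.
  - by rewrite /= prednK ?om1 // ltnW.
have := char_poly_border _ _ N v K N_upper NKv.
rewrite -Rstar_border; set q : {poly rat} := (_ - \sum_(_ < _) _).
have t1 : ('X - 1 : {poly rat}).[1] = 0 by rewrite -polyC1 hornerXsubC subrr.
(* At 1 only the summand [k = K] survives, so [q] takes the value [- c K 0 0], which is nonzero. *)
have q1 : ~~ root q 1.
  rewrite /root /q hornerD hornerN horner_sum horner_exp t1 expr0n add0r oppr_eq0.
  rewrite big_ord_recr /= subnn expr0 mulr1 hornerC big1 ?add0r ?gt_eqF // => k _.
  by rewrite hornerM horner_exp t1 expr0n subn_eq0 leqNgt ltn_ord mulr0.
have chi0 : char_poly (Rstar n.+1) != 0 by rewrite monic_neq0 // char_poly_monic.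
have tX k : ('X - 1 : {poly rat}) ^+ k != 0.
  by rewrite expf_neq0 // -polyC1 polyXsubC_eq0.
have mu k : mup 1 (('X - 1 : {poly rat}) ^+ k) = k.
  by rewrite -polyC1 mup_XsubCX eqxx.
move/(congr1 (mup 1)); rewrite mupM // mupMl // !mu kE.
by move: (mup 1 _) => d <-; rewrite addKn.
Qed.

End UnitaryDivisorMatrix.

Lemma mult1E n : (0 < n)%N -> mult1 n = (n - kseq n)%N.
Proof. by case: n => // n _; exact: mult1S. Qed.

(** * Primorials and the prime-counting function [ppi] *)

Definition prime_seq x := [seq p <- iota 1 x | prime p].
Definition ppi x := size (prime_seq x).
Definition primorial x := (\prod_(p <- prime_seq x) p)%N.

Lemma prime_seqS x :
  prime_seq x.+1 = if prime x.+1 then rcons (prime_seq x) x.+1 else prime_seq x.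
Proof. by rewrite /prime_seq -{1}(addn1 x) iotaD cats1 filter_rcons add1n. Qed.

Lemma mem_prime_seq x p : (p \in prime_seq x) = prime p && (p <= x)%N.
Proof.
rewrite mem_filter mem_iota; have [/prime_gt0 p0|//] := boolP (prime p).
by rewrite p0 add1n ltnS.
Qed.

Lemma prime_seq_uniq x : uniq (prime_seq x).
Proof. by rewrite filter_uniq // iota_uniq. Qed.

Lemma ppiS x : ppi x.+1 = (ppi x + prime x.+1)%N.
Proof.
by rewrite /ppi prime_seqS; case: prime; rewrite ?size_rcons ?addn1 ?addn0.
Qed.

Lemma leq_ppi x y : (x <= y)%N -> (ppi x <= ppi y)%N.
Proof.
move=> /subnK <-; elim: (y - x)%N => // k IH; rewrite addSn ppiS.
exact: leq_trans (leq_addr _ _).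
Qed.

Lemma primorialS x :
  primorial x.+1 = ((if prime x.+1 then x.+1 else 1) * primorial x)%N.
Proof.
rewrite /primorial prime_seqS; case: prime; rewrite ?mul1n //.
by rewrite -cats1 big_cat big_seq1 /= mulnC.
Qed.

Lemma primorial_gt0 x : (0 < primorial x)%N.
Proof.
elim: x => [|x IH]; first by rewrite /primorial big_nil.
by rewrite primorialS muln_gt0 IH; case: prime.
Qed.

Lemma leq_primorial x y : (x <= y)%N -> (primorial x <= primorial y)%N.
Proof.
move=> /subnK <-; elim: (y - x)%N => // d IH; rewrite addSn primorialS.
by apply: leq_trans IH _; rewrite leq_pmull //; case: prime.
Qed.

Lemma coprime_primorial x : prime x.+1 -> coprime x.+1 (primorial x).
Proof.
move=> pp; rewrite prime_coprime // /primorial Euclid_dvd_prod //.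
rewrite big_has -all_predC; apply/allP => p /=.
rewrite mem_prime_seq => /andP[/prime_gt0 p0 px]; rewrite gtnNdvd //.
Qed.

Lemma omega_primorial x : omega (primorial x) = ppi x.
Proof.
elim: x => [|x IH]; first by rewrite /primorial big_nil.
rewrite primorialS ppiS; case: (boolP (prime x.+1)) => pp; last by rewrite mul1n addn0.
rewrite omegaM ?primorial_gt0 ?coprime_primorial // IH addnC.
by rewrite /omega primes_prime.
Qed.

Lemma primorial_dvd x m : (forall p, prime p -> (p <= x)%N -> (p %| m)%N) ->
  (primorial x %| m)%N.
Proof.
elim: x => [|x IH] H; first by rewrite /primorial big_nil dvd1n.
have H' : (primorial x %| m)%N by apply: IH => p pp px; apply: H => //; exact: ltnW.
rewrite primorialS; case: ifPn => pp; last by rewrite mul1n.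
by rewrite Gauss_dvd ?coprime_primorial // H' H.
Qed.

Lemma prod_primes_leq m : (0 < m)%N -> (\prod_(p <- primes m) p <= m)%N.
Proof.
move=> m0; rewrite [leqRHS]prod_prime_decomp // prime_decompE big_map /=.
rewrite big_seq [leqRHS]big_seq; apply: leq_prod => p.
rewrite -logn_gt0 => l0; rewrite -[leqLHS]expn1 leq_pexp2l //.
by move: l0; rewrite logn_gt0 mem_primes => /and3P[/prime_gt0].
Qed.

(** When [x + 1] is prime, [s] has more elements than there are primes up to [x], hence one above
    [x]; removing it takes away a factor of at least [x + 1]. *)
Lemma primorial_leq_prod x (s : seq nat) : uniq s -> all prime s ->
  (ppi x <= size s)%N -> (primorial x <= \prod_(p <- s) p)%N.
Proof.
elim: x s => [|x IH] s us ps le.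
  rewrite {1}/primorial big_nil big_seq prodn_cond_gt0 // => p.
  by move/(allP ps)/prime_gt0.
rewrite primorialS; move: le; rewrite ppiS.
case: (boolP (prime x.+1)) => pp; last by rewrite addn0 mul1n; exact: IH.
rewrite addn1 => le.
have /hasP[q qs xq] : has (fun q => x < q)%N s.
  apply: contraLR le; rewrite -all_predC => /allP alls.
  rewrite -ltnNge ltnS; apply: uniq_leq_size => // q qs.
  by rewrite mem_prime_seq (allP ps) //= leqNgt; exact: alls.
rewrite (perm_big _ (perm_to_rem qs)) big_cons leq_mul //.
apply: IH; first exact: rem_uniq.
  by apply/allP => p /mem_rem; exact: (allP ps).
by rewrite size_rem // -ltnS prednK // (leq_ltn_trans _ le).
Qed.

(** For the largest [x] with [primorial x <= n], the number [primorial x] itself has [ppi x] prime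
    factors, while any number with more is at least [primorial x.+1]. *)
Lemma kseq_ppi n : (1 < n)%N ->
  exists x, [/\ kseq n = (ppi x).+1, (primorial x <= n)%N & (n < primorial x.+1)%N].
Proof.
move=> n1.
have ex : exists x, (primorial x <= n)%N.
  by exists 0%N; rewrite /primorial big_nil ltnW.
(* A prime [q > n] has [primorial q > n], which bounds the search for [x]. *)
have [q nq qp] := prime_above n.
have bd x : (primorial x <= n)%N -> (x <= q)%N.
  move=> le; rewrite leqNgt; apply: contraL le => qx.
  rewrite -ltnNge (leq_trans nq) // (leq_trans _ (leq_primorial _ _ (ltnW qx))) //.
  case: q {nq qx} qp => // q qp; rewrite primorialS qp leq_pmulr //.
  exact: primorial_gt0.
case: (ex_maxnP ex bd) => x le max; exists x.
have lt : (n < primorial x.+1)%N by rewrite ltnNge; apply/negP => /max; rewrite ltnn.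
split => //; apply/eqP; rewrite eqn_leq; apply/andP; split; last first.
  by rewrite -omega_primorial kseq_omega_ltn.
have [m [m1 mn ->]] := kseq_omega_ex _ n1; rewrite ltnS leqNgt; apply/negP => om.
move: lt; rewrite ltnNge => /negP; apply; apply: leq_trans mn.
apply: leq_trans (prod_primes_leq _ (ltnW m1)).
apply: primorial_leq_prod; first exact: primes_uniq.
  by apply/allP => p; rewrite mem_primes => /andP[].
by rewrite ppiS; move: om; rewrite /omega; case: prime => /=; lia.
Qed.

(** * Chebyshev-type bounds from binomial coefficients *)

Lemma prime_ndvd_fact p k : prime p -> (k < p)%N -> ~~ (p %| k`!)%N.
Proof.
move=> pp; elim: k => [|k IH] kp; first by rewrite fact0 Euclid_dvd1.
by rewrite factS Euclid_dvdM // negb_or gtnNdvd // IH // ltnW.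
Qed.

Lemma sum_bin n : (\sum_(i < n.+1) 'C(n, i) = 2 ^ n)%N.
Proof.
by rewrite -[2%N]/(1 + 1)%N expnDn; apply: eq_bigr => i _; rewrite !exp1n !muln1.
Qed.

(** The two middle coefficients of row [2m + 1] are equal and add up to at most [2^(2m+1)]. *)
Lemma bin_odd_mid m : ('C(m.*2.+1, m) <= 4 ^ m)%N.
Proof.
have lt1 : (m < m.*2.+2)%N by lia.
have lt2 : (m.+1 < m.*2.+2)%N by lia.
have : ('C(m.*2.+1, m) + 'C(m.*2.+1, m.+1) <= 2 ^ m.*2.+1)%N.
  rewrite -sum_bin (bigD1 (Ordinal lt1)) //= leq_add2l.
  by rewrite (bigD1 (Ordinal lt2)) ?leq_addr // -val_eqE /=; lia.
rewrite -[X in (_ + X)%N]bin_sub; last by lia.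
rewrite (_ : m.*2.+1 - m.+1 = m)%N; last by lia.
rewrite (_ : 2 ^ m.*2.+1 = 2 * 4 ^ m)%N; first by lia.
by rewrite expnS -mul2n expnM.
Qed.

(** Strong induction. At an odd prime [2m + 1], the primes up to [m + 1] fall under the induction
    hypothesis, and those in [(m + 1, 2m + 1]] all divide ['C(2m+1, m)]. *)
Lemma primorial_leq_exp4 x : (primorial x <= 4 ^ x)%N.
Proof.
elim/ltn_ind: x => -[|x] IH; first by rewrite /primorial big_nil.
have [pp|npp] := boolP (prime x.+1); last first.
  rewrite primorialS (negbTE npp) mul1n (leq_trans (IH x _)) //.
  by rewrite leq_exp2l.
have [->|x1] := eqVneq x 1%N; first by rewrite primorialS /primorial big_nil.
have /even_prime[|ox] := pp; first by lia.
have [m xE] : exists m, x = m.*2 by exists x./2; lia.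
have m0 : (0 < m)%N by case: m xE pp => // ->.
rewrite xE; apply: (@leq_trans ('C(m.*2.+1, m) * primorial m.+1)); last first.
  apply: leq_trans (leq_mul (bin_odd_mid m) (IH m.+1 _)) _; first by lia.
  by rewrite -expnD leq_exp2l //; lia.
apply: dvdn_leq.
  by rewrite muln_gt0 primorial_gt0 andbT bin_gt0; lia.
apply: primorial_dvd => p pp' px.
have [le|lt] := leqP p m.+1.
  rewrite dvdn_mull // /primorial (big_rem p) /= ?dvdn_mulr //.
  by rewrite mem_prime_seq pp'.
rewrite dvdn_mulr //.
have pf k := prime_ndvd_fact _ k pp'.
have : (p %| (m.*2.+1)`!)%N by rewrite dvdn_fact // prime_gt0.
rewrite -(@bin_fact m.*2.+1 m) ?Euclid_dvdM //; last by lia.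
rewrite (negbTE (pf m _)) ?(negbTE (pf (_ - m)%N _)) ?orbF //; lia.
Qed.

(** Induction by ['C(2m+2, m+1) = 2 'C(2m+1, m)] and [(m+1) 'C(2m+1, m) = (2m+1) 'C(2m, m)]. *)
Lemma central_bin_geq m : (0 < m)%N -> (4 ^ m <= m.*2 * 'C(m.*2, m))%N.
Proof.
elim: m => // -[|m] IH _; first by [].
have {IH} := IH isT; move: m.+1 (ltn0Sn m) => {}m m0 IH.
have := mul_bin_diag m.+1.*2 m; have := mul_bin_down m.*2.+1 m.
rewrite /= (_ : m.*2.+1 - m = m.+1)%N; last by lia.
move: IH; set A := 'C(m.*2, m); set B := 'C(m.*2.+1, m); rewrite doubleS expnS.
set D := 'C(_, _) => IH AB BD.
have DE : (D = 2 * B)%N.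
  by apply/eqP; rewrite -(eqn_pmul2l (ltn0Sn m)) -BD; apply/eqP; lia.
by rewrite DE; nia.
Qed.

(** Legendre's formula: each term [floor(2m / p^k) - 2 floor(m / p^k)] is at most 1, and it vanishes
    once [p^k > 2m]. *)
Lemma logn_central_bin p m : prime p -> (0 < m)%N ->
  (logn p 'C(m.*2, m) <= trunc_log p m.*2)%N.
Proof.
move=> pp m0; have p1 := prime_gt1 pp; set n := m.*2.
have nE : (n - m = m)%N by rewrite /n; lia.
have mn : (m <= n)%N by rewrite /n; lia.
have E : (logn p n`! = logn p 'C(n, m) + (logn p m`! + logn p m`!))%N.
  by rewrite -(bin_fact mn) nE !lognM ?muln_gt0 ?fact_gt0 // bin_gt0.
have Em : logn p m`! = (\sum_(1 <= k < n.+1) m %/ p ^ k)%N.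
  rewrite logn_fact // [RHS](@big_cat_nat _ _ _ m.+1) //= [X in _ = (_ + X)%N]big_nat.
  rewrite [X in _ = (_ + X)%N]big1 ?addn0 // => k /andP[mk _]; rewrite divn_small //.
  by rewrite (ltn_trans mk) // ltn_expl.
have le : (logn p n`! <= logn p m`! + logn p m`! +
    \sum_(1 <= k < n.+1) (k <= trunc_log p n))%N.
  rewrite logn_fact // Em -!big_split /=; apply: leq_sum => k _.
  have pk : (0 < p ^ k)%N by rewrite expn_gt0 ltnW.
  have [kl|kl] := leqP k (trunc_log p n).
    rewrite -ltnS ltn_divLR //.
    have := ltn_ceil m pk; rewrite /n; set q := (m %/ _)%N; move: (p ^ k)%N; nia.
  rewrite divn_small // ltnNge; apply: contraTN kl => le.
  by rewrite -leqNgt trunc_log_max.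
have : (\sum_(1 <= k < n.+1) (k <= trunc_log p n) <= trunc_log p n)%N.
  have bd N : (\sum_(1 <= k < N.+1) (k <= trunc_log p n) <= minn N (trunc_log p n))%N.
    elim: N => [|N IH]; first by rewrite big_geq.
    rewrite big_nat_recr //=; move: IH.
    by move: (\sum_(_ <= _ < _) _)%N => S; case: leqP; lia.
  by apply: leq_trans (bd n) _; exact: geq_minr.
by lia.
Qed.

(* A prime above [s] has its square beyond [2m], so it divides the central
   binomial coefficient at most once. *)
Lemma central_bin_leq m s : (0 < m)%N -> (m.*2 < s.+1 ^ 2)%N ->
  ('C(m.*2, m) <= m.*2 ^ s * primorial m.*2)%N.
Proof.
move=> m0 ms; set n := m.*2; set C := 'C(n, m).
have n0 : (0 < n)%N by rewrite /n; lia.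
have C0 : (0 < C)%N by rewrite bin_gt0 /n; lia.
pose c p := if (p <= s)%N then n else 1%N.
have c0 p : (0 < c p)%N by rewrite /c; case: ifP.
have sub p : p \in primes C -> p \in prime_seq n.
  rewrite mem_primes mem_prime_seq => /and3P[pp _ pC]; rewrite pp /=.
  rewrite leqNgt; apply: contraL pC => np.
  apply: contra (prime_ndvd_fact _ _ pp np) => pC; rewrite -(@bin_fact n m) ?dvdn_mulr //.
  by rewrite /n; lia.
rewrite {1}[C]prod_prime_decomp // prime_decompE big_map /=.
apply: (@leq_trans (\prod_(p <- primes C) (c p * p))).
  rewrite big_seq [leqRHS]big_seq; apply: leq_prod => p.
  rewrite mem_primes => /and3P[pp _ _]; have p1 := prime_gt1 pp.
  have le := logn_central_bin _ _ pp m0.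
  have bd : (p ^ logn p C <= n)%N.
    by apply: leq_trans (trunc_logP p1 n0); rewrite leq_pexp2l // ltnW.
  rewrite /c; case: (leqP p s) => ps; first by rewrite (leq_trans bd) // leq_pmulr // ltnW.
  suff l1 : (logn p C <= 1)%N.
    by rewrite mul1n -{2}(expn1 p) (leq_pexp2l _ l1) // ltnW.
  rewrite -ltnS; apply: leq_ltn_trans le _.
  rewrite -(@ltn_exp2l p) //; apply: leq_ltn_trans (trunc_logP p1 n0) _.
  by apply: leq_trans ms _; rewrite leq_exp2r.
apply: (@leq_trans (\prod_(p <- prime_seq n) (c p * p))).
  have -> : (\prod_(p <- primes C) (c p * p) =
             \prod_(p <- prime_seq n | p \in primes C) (c p * p))%N.
    rewrite -[RHS]big_filter; apply: perm_big; apply: uniq_perm.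
    - exact: primes_uniq.
    - by rewrite filter_uniq // prime_seq_uniq.
    - by move=> p; rewrite mem_filter; case: (boolP (p \in primes C)) => // /sub ->.
  rewrite big_mkcond /= big_seq [leqRHS]big_seq; apply: leq_prod => p.
  by rewrite mem_prime_seq => /andP[/prime_gt0 p0 _]; case: ifP => // _; rewrite muln_gt0 c0.
rewrite big_split /= leq_mul2r; apply/orP; right.
rewrite -big_mkcond /= -big_filter big_const_seq count_predT iter_muln_1 leq_pexp2l //.
rewrite -[leqRHS](size_iota 1); apply: uniq_leq_size.
  by rewrite filter_uniq // prime_seq_uniq.
move=> p; rewrite mem_filter mem_prime_seq mem_iota => /and3P[ps /prime_gt0 p0 _].
by rewrite p0 add1n ltnS.
Qed.

Lemma primorial_geq m s : (0 < m)%N -> (m.*2 < s.+1 ^ 2)%N ->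
  (2 ^ m.*2 <= m.*2 ^ s.+1 * primorial m.*2)%N.
Proof.
move=> m0 ms; rewrite -mul2n expnM mul2n.
apply: leq_trans (central_bin_geq _ m0) _.
by rewrite expnS -mulnA leq_mul2l central_bin_leq ?orbT.
Qed.

(** * Inequalities for [L / ln L] and [L / ln L ^+ 2] *)

Section RealBounds.
Variable R : realType.
Implicit Types A B L a y : R.

Let e : R := expR 1.
Let S n : R := series (exp_coeff 1) n.

Let SS n : S n.+1 = S n + (n`!%:R)^-1.
Proof. by rewrite /S /series /= big_nat_recr //= /exp_coeff /= expr1n mul1r. Qed.

Let S8 : S 8 = 685%:R / 252%:R.
Proof.
rewrite !SS /S /series /= big_geq // fact0 (_ : 1`! = 1)%N // (_ : 2`! = 2)%N //.
rewrite (_ : 3`! = 6)%N // (_ : 4`! = 24)%N // (_ : 5`! = 120)%N //.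
by rewrite (_ : 6`! = 720)%N // (_ : 7`! = 7 * 720)%N // natrM; field.
Qed.

Lemma expR1_ge : 492%:R / 181%:R <= e.
Proof.
have : S 8 <= e.
  apply: nondecreasing_cvgn_le; last exact: is_cvg_series_exp_coeff.
  by apply: nondecreasing_series => n _ _; exact: exp_coeff_ge0.
by rewrite S8; lra.
Qed.

Lemma expR1_le : e <= 193%:R / 71%:R.
Proof.
(* With [k = n + 7], adding [1 / (k k!)] to the partial sum through [1 / k!] gives a quantity that
   decreases in [n], so its value at [n = 0] bounds the limit. *)
have bd n : S (n + 8)%N + ((n + 7)%:R * (n + 7)`!%:R)^-1 <= 193%:R / 71%:R.
  elim: n => [|n IH].
    by rewrite !add0n S8 (_ : 7`! = 7 * 720)%N // !natrM; lra.
  apply: le_trans IH; rewrite addSn SS -addrA lerD2l addSn.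
  have -> : (n + 8 = (n + 7).+1)%N by lia.
  rewrite factS; set k := (n + 7)%N; have k0 : 0 < k%:R :> R by rewrite ltr0n /k; lia.
  have f0 : 0 < k`!%:R :> R by rewrite ltr0n fact_gt0.
  rewrite natrM -[k.+1%:R]natr1 !invfM -subr_ge0.
  have -> : k%:R^-1 / k`!%:R -
    ((k%:R + 1)^-1 / k`!%:R + (k%:R + 1)^-1 * ((k%:R + 1)^-1 / k`!%:R)) =
    (k%:R * (k%:R + 1) ^+ 2 * k`!%:R)^-1 :> R.
    by field; rewrite !gt_eqF //; lra.
  by rewrite invr_ge0 !mulr_ge0 // ?sqr_ge0 // ltW.
apply: limr_le; first exact: is_cvg_series_exp_coeff.
near=> n.
have -> : n = ((n - 8) + 8)%N by rewrite subnK //; near: n; exact: nbhs_infty_ge.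
apply: le_trans (bd (n - 8)%N); rewrite lerDl invr_ge0 mulr_ge0 //.
Unshelve. all: by end_near. Qed.

Let ln_e : ln e = 1.
Proof. exact: expRK. Qed.

Lemma ln_le_sub1 A : 0 < A -> ln A <= A - 1.
Proof. by move=> A0; have := @le_ln1Dx R (A - 1); rewrite [1 + _]addrC subrK; apply; lra. Qed.

(** The graph of [ln] lies below its tangent at [A]. Used at either end of an interval, this
    replaces the mean value theorem. *)
Lemma ln_sub_le A B : 0 < A -> 0 < B -> ln B - ln A <= (B - A) / A.
Proof.
move=> A0 B0; rewrite -ln_div ?posrE //.
by apply: le_trans (ln_le_sub1 _ _) _; rewrite ?divr_gt0 // mulrBl divff ?gt_eqF.
Qed.

Lemma ln_ge1 A : e <= A -> 1 <= ln A.
Proof.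
move=> eA; rewrite -ln_e ler_ln // ?posrE ?expR_gt0 //.
by apply: lt_le_trans eA; exact: expR_gt0.
Qed.

Lemma div_ln_le A B : e <= A -> A <= B -> A / ln A <= B / ln B.
Proof.
move=> eA AB; have A0 : 0 < A by apply: lt_le_trans eA; exact: expR_gt0.
have B0 : 0 < B by exact: lt_le_trans AB.
have lA := ln_ge1 _ eA; have lB := ln_ge1 _ (le_trans eA AB).
have := ln_sub_le _ _ A0 B0; rewrite ler_pdivlMr // => H.
rewrite ler_pdivrMr; last by lra.
rewrite mulrAC ler_pdivlMr; last by lra.
by nra.
Qed.

(** The tangent at [e] gives [ln A <= A / e], so the minimum is [e > 2.7]. *)
Lemma div_ln_ge A : 1 < A -> 27%:R / 10%:R <= A / ln A.
Proof.
move=> A1; have l0 : 0 < ln A by exact: ln_gt0.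
have e0 : 0 < e by exact: expR_gt0.
have := ln_sub_le _ _ e0 (lt_trans ltr01 A1); rewrite ln_e ler_pdivlMr // => H.
have := expR1_ge; rewrite ler_pdivlMr // => ?.
by nra.
Qed.

(** Transfers monotonicity and the minimum from [s / ln s] to [A / ln A ^+ 2], where [s] is the
    square root of [A]. *)
Lemma div_ln_sqr_sqrt A : 0 < A ->
  A / ln A ^+ 2 = (Num.sqrt A / ln (Num.sqrt A)) ^+ 2 / 4%:R.
Proof.
move=> A0; have s0 : 0 < Num.sqrt A by rewrite sqrtr_gt0.
have sE : A = Num.sqrt A ^+ 2 by rewrite sqr_sqrtr // ltW.
rewrite {1 2}sE lnXn // -[ln _ *+ 2]mulr_natl exprMn expr_div_n invfM.
by rewrite -natrX mulrC -mulrA [RHS]mulrC [_ * _ ^+ 2]mulrC.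
Qed.

(** The function increases from [e^2] on, and [e^2 < 8]. *)
Lemma div_ln_sqr_le A B : 8%:R <= A -> A <= B -> A / ln A ^+ 2 <= B / ln B ^+ 2.
Proof.
move=> A8 AB; have A0 : 0 < A by lra.
have eA : e <= Num.sqrt A.
  have e_le := expR1_le; have e0 : 0 < e by exact: expR_gt0.
  rewrite -(@ler_pXn2r _ 2) ?nnegrE ?sqrtr_ge0 ?sqr_sqrtr //; [|exact: ltW..].
  by apply: le_trans A8; nra.
have sAB : Num.sqrt A <= Num.sqrt B by rewrite ler_sqrt //; lra.
rewrite !div_ln_sqr_sqrt //; last by lra.
rewrite ler_pM2r // ler_pXn2r ?nnegrE ?div_ln_le //.
  by rewrite divr_ge0 ?sqrtr_ge0 // (le_trans ler01) // ln_ge1.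
by rewrite divr_ge0 ?sqrtr_ge0 // (le_trans ler01) // ln_ge1 // (le_trans eA).
Qed.

Lemma div_ln_sqr_ge A : 1 < A -> 18%:R / 10%:R <= A / ln A ^+ 2.
Proof.
move=> A1; rewrite div_ln_sqr_sqrt; last by lra.
have s1 : 1 < Num.sqrt A by rewrite -[ltLHS]sqrtr1 ltr_sqrt //; lra.
by have := div_ln_ge _ s1; set q := _ / ln _; nra.
Qed.

(** For [a = ln p] the hypothesis [a <= 1 + ln L] reads [p <= e L]. With [y = ln L] and
    [u = ln (L + a)], the claim becomes [y (a - y) <= (L + y) (u - y)]. *)
Lemma div_ln_add_le L a : 1 < L -> 0 < a -> a <= 1 + ln L ->
  (L + a) / ln (L + a) <= L / ln L + 1.
Proof.
move=> L1 a0 aL; have y0 : 0 < ln L by exact: ln_gt0.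
have La0 : 0 < L + a by lra.
have L0 : 0 < L by lra.
have := ln_sub_le _ _ La0 L0.
have : ln L <= ln (L + a) by rewrite ler_ln ?posrE //; lra.
set y := ln L in y0 aL *; set u := ln (L + a) => yu.
rewrite ler_pdivlMr // => H.
rewrite ler_pdivrMr; last by lra.
have -> : L / y + 1 = (L + y) / y by field; lra.
rewrite mulrAC ler_pdivlMr //.
(* With [d = u - y]: either [a <= y], or [a - y <= 1] and [d (L + a) >= a]. *)
have [ay|ya] := leP a y; first by nra.
have d0 : 0 <= u - y by lra.
suff : y * (a - y) <= (L + y) * (u - y) by lra.
have H1 : y * (a - y) * (L + a) <= (L + y) * a.
  rewrite -subr_ge0 (_ : _ - _ = (1 - (a - y)) * y * (L + a) + L * (a - y)); last by ring.
  by rewrite addr_ge0 // mulr_ge0; try apply: mulr_ge0; lra.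
rewrite -(@ler_pM2r _ (L + a)) //; apply: le_trans H1 _.
by rewrite -mulrA ler_pM2l; lra.
Qed.

(** The derivative of [L / ln L] is [1/y - 1/y^2] with [y = ln L]. The hypothesis says that [c a]
    times this, taken at [L + a] and with the correction [a / L], is at least 1. *)
Lemma div_ln_add_ge (c : R) L a : 0 < c -> 1 < L -> 0 < a ->
    ln (L + a) ^+ 2 <= c * (a * (ln (L + a) - 1 - a / L)) ->
  c * (L / ln L) + 1 <= c * ((L + a) / ln (L + a)).
Proof.
move=> c0 L1 a0; have u0 : 0 < ln L by exact: ln_gt0.
have La0 : 0 < L + a by lra.
have L0 : 0 < L by lra.
have := ln_sub_le _ _ L0 La0.
have : ln L <= ln (L + a) by rewrite ler_ln ?posrE //; lra.
set u := ln L in u0 *; set y := ln (L + a) => uy.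
rewrite [L + a]addrC addrK; set eps := a / L => dE H.
have eL : eps * L = a by rewrite /eps divfK // gt_eqF.
rewrite !mulrA; have -> : c * L / u + 1 = (c * L + u) / u by field; lra.
rewrite ler_pdivrMr // mulrAC ler_pdivlMr; last by lra.
have : (a + L) * (y - u) <= (a + L) * eps by rewrite ler_pM2l //; lra.
have -> : (a + L) * eps = a * (1 + eps) by rewrite mulrDl [L * _]mulrC eL; ring.
by move=> H2; nra.
Qed.

(** The same argument for [L / ln L + 2 L / (ln L)^2], whose derivative is [1/y + 1/y^2 - 4/y^3]. *)
Lemma div_ln_sqr_add_ge L a : 1 < L -> 0 < a -> a <= 1 + ln L -> 1 <= ln (L + a) ->
    ln (L + a) ^+ 3 <=
      a * (ln (L + a) ^+ 2 + ln (L + a) - 4%:R - a / L * (ln (L + a) + 4%:R)) ->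
  L / ln L + 2%:R * (L / ln L ^+ 2) + 1 <=
  (L + a) / ln (L + a) + 2%:R * ((L + a) / ln (L + a) ^+ 2).
Proof.
move=> L1 a0 aL y1; have u0 : 0 < ln L by exact: ln_gt0.
have La0 : 0 < L + a by lra.
have L0 : 0 < L by lra.
have := ln_sub_le _ _ L0 La0.
have : ln L <= ln (L + a) by rewrite ler_ln ?posrE //; lra.
set u := ln L in u0 aL *; set y := ln (L + a) in y1 * => uy.
rewrite [L + a]addrC addrK; set eps := a / L => dE H.
have eL : eps * L = a by rewrite /eps divfK // gt_eqF.
have -> : L / u + 2%:R * (L / u ^+ 2) + 1 = (L * (u + 2%:R) + u ^+ 2) / u ^+ 2.
  by field; lra.
have -> : (a + L) / y + 2%:R * ((a + L) / y ^+ 2) = (a + L) * (y + 2%:R) / y ^+ 2.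
  by field; lra.
have y0 : 0 < y by lra.
rewrite ler_pdivrMr ?exprn_gt0 // mulrAC ler_pdivlMr ?exprn_gt0 //.
have H2 : (a + L) * (y - u) <= a * (1 + eps).
  have -> : a * (1 + eps) = (a + L) * eps by rewrite mulrDl [L * _]mulrC eL; ring.
  by rewrite ler_pM2l //; lra.
have H3 : (a + L) * (y - u) * (y + 4%:R) <= a * (1 + eps) * (y + 4%:R).
  by rewrite ler_pM2r //; lra.
pose d := y - u; have uE : u = y - d by rewrite /d; ring.
have d0 : 0 <= d by rewrite /d; lra.
(* The last factor is [y + u - a], nonnegative because [a <= 1 + u] and [1 <= y]. *)
have H4 : 0 <= d * y * (2%:R * y - a - d).
  by apply: mulr_ge0; [apply: mulr_ge0; lra|rewrite /d; lra].
have H5 : 0 <= (a + L) * (y + 2%:R) * d ^+ 2.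
  by rewrite mulr_ge0 ?sqr_ge0 // mulr_ge0; lra.
have H6 : (a + L) * d * (y + 4%:R) + y * u ^+ 2 <= a * y * (y + 2%:R - d).
  by move: H H3 H4; rewrite -/d uE; lra.
have H7 : y * ((a + L) * d * (y + 4%:R) + y * u ^+ 2) <= y * (a * y * (y + 2%:R - d)).
  by rewrite ler_pM2l.
by move: H7 H5; rewrite uE; lra.
Qed.

End RealBounds.

(** * Certified evaluation in binary arithmetic *)

(* Numerical facts about primorials are evaluated on binary numbers only; the
   corresponding closed powers in [nat] must never be reduced. *)
Local Notation BN := BinNat.N.of_nat.

Fixpoint powN (b : BinNums.N) (k : nat) : BinNums.N :=
  if k is k'.+1 then BinNat.N.mul b (powN b k') else BN 1.

Lemma powN_of_nat b k : powN (BN b) k = BN (b ^ k).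
Proof. by elim: k => // k IH; rewrite /= IH expnS; lia. Qed.

Lemma lebN_of_nat a b : BinNat.N.leb (BN a) (BN b) -> (a <= b)%N.
Proof. lia. Qed.

Lemma log2N_bounds m : (0 < m)%N ->
  (2 ^ (BinNat.N.to_nat (BinNat.N.log2 (BN m))) <= m)%N /\
  (m < 2 ^ (BinNat.N.to_nat (BinNat.N.log2 (BN m))).+1)%N.
Proof.
move=> m0; have [|lo hi] := BinNat.N.log2_spec (BN m); first by lia.
set l := BinNat.N.log2 _ in lo hi *.
have E k : BN (2 ^ k) = BinNat.N.pow (BN 2) (BN k).
  elim: k => // k IH.
  by rewrite (Nnat.Nat2N.inj_succ k) BinNat.N.pow_succ_r' -IH expnS; lia.
split; first by apply: lebN_of_nat; rewrite E Nnat.N2Nat.id; apply/BinNat.N.leb_le.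
suff : BinNat.N.leb (BinNat.N.succ (BN m)) (BN (2 ^ (BinNat.N.to_nat l).+1)) by lia.
rewrite E (Nnat.Nat2N.inj_succ (BinNat.N.to_nat l)) Nnat.N2Nat.id.
by apply/BinNat.N.leb_le/BinNat.N.le_succ_l.
Qed.

(** [K] and [P] carry the prime count and the primorial of [x], so a single pass tests every [x]
    without recomputing a product. *)
Fixpoint scan (f : nat -> nat -> BinNums.N -> bool) (k x K : nat) (P : BinNums.N) :=
  if k is k'.+1 then
    f x K P &&
    (if prime x.+1 then scan f k' x.+1 K.+1 (BinNat.N.mul (BN x.+1) P)
     else scan f k' x.+1 K P)
  else true.

Lemma scanP f k : scan f k 0 0 (BN 1) ->
  forall x, (x < k)%N -> f x (ppi x) (BN (primorial x)).
Proof.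
suff H x : scan f k x (ppi x) (BN (primorial x)) ->
    forall y, (x <= y < x + k)%N -> f y (ppi y) (BN (primorial y)).
  move=> sc x xk; apply: (H 0%N); last by rewrite add0n.
  by rewrite /primorial big_nil.
elim: k x => [|k IH] x /=; first by move=> _ y; lia.
case/andP => fx sc y; have [->//|xy] := eqVneq y x => ylt.
apply: (IH x.+1); last by lia.
rewrite primorialS ppiS; case: ifP sc => pp; rewrite ?addn1 ?addn0 ?mul1n //.
by rewrite Nnat.Nat2N.inj_mul.
Qed.

(** Integer forms of linear bounds on theta: at least [5/9 (x+1) ln 2] for [5 <= x < 29], then
    between [(x+1) ln 2] and [3/2 x ln 2]. The factor 5/9 is enough because [5/9 ln 2 > 1/e]. *)
Definition size_check (x _ : nat) (P : BinNums.N) :=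
  let l := BinNat.N.log2 P in
  if (x < 5)%N then true else
  if (x < 29)%N then BinNat.N.leb (BN (5 * x.+1)) (BinNat.N.log2 (powN P 9))
  else BinNat.N.leb (BN x.+1) l &&
       BinNat.N.leb (BinNat.N.mul (BN 2) (BinNat.N.succ l)) (BN (3 * x)).

Lemma size_checked : scan size_check 801 0 0 (BN 1).
Proof. by vm_compute. Qed.

Lemma primorial_ge_small x : (5 <= x < 29)%N -> (2 ^ (5 * x.+1) <= primorial x ^ 9)%N.
Proof.
move=> xb; have xl : (x < 801)%N by lia.
have := scanP _ _ size_checked x xl; rewrite /size_check.
have [-> ->] : (x < 5)%N = false /\ (x < 29)%N by lia.
rewrite powN_of_nat.
have [|lo _] := log2N_bounds (primorial x ^ 9); first by rewrite expn_gt0 primorial_gt0.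
by move=> le; apply: leq_trans lo; rewrite leq_exp2l //; lia.
Qed.

Lemma primorial_ge_mid x : (29 <= x <= 800)%N -> (2 ^ x.+1 <= primorial x)%N.
Proof.
move=> /andP[xb xl]; have := scanP _ _ size_checked x xl; rewrite /size_check.
have [-> ->] : (x < 5)%N = false /\ (x < 29)%N = false by lia.
move=> /andP[le _].
have [lo _] := log2N_bounds _ (primorial_gt0 x).
by apply: leq_trans lo; rewrite leq_exp2l //; lia.
Qed.

Lemma primorial_le_mid x : (29 <= x <= 800)%N -> (primorial x ^ 2 <= 2 ^ (3 * x))%N.
Proof.
move=> /andP[xb xl]; have := scanP _ _ size_checked x xl; rewrite /size_check.
have [-> ->] : (x < 5)%N = false /\ (x < 29)%N = false by lia.
move=> /andP[_ le].
have [_ hi] := log2N_bounds _ (primorial_gt0 x).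
apply: (@leq_trans ((2 ^ (BinNat.N.to_nat (BinNat.N.log2 (BN (primorial x)))).+1) ^ 2)).
  by rewrite leq_exp2r // ltnW.
by rewrite -expnM leq_exp2l //; lia.
Qed.

(* Entry [(a, b, c, d)] number [K - 4] certifies [a / b <= ln P] and
   [ln (a / b) <= c / d], where [P] is the product of the first [K] primes.
   At [K = 9] the constant 1.3841 is nearly attained. *)
Definition cert_table : seq (nat * nat * nat * nat) :=
  [:: (5, 1, 5, 3); (22, 3, 2, 1); (41, 4, 7, 3); (13, 1, 59, 23);
      (209, 13, 25, 9); (173, 9, 337, 114); (45, 2, 137, 44); (26, 1, 49, 15);
      (59, 2, 17, 5); (33, 1, 7, 2); (37, 1, 29, 8); (81, 2, 26, 7);
      (44, 1, 19, 5); (48, 1, 31, 8); (53, 1, 4, 1); (57, 1, 29, 7);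
      (61, 1, 21, 5); (65, 1, 17, 4); (69, 1, 13, 3); (73, 1, 13, 3);
      (79, 1, 9, 2); (82, 1, 9, 2); (86, 1, 9, 2); (90, 1, 9, 2);
      (95, 1, 14, 3); (100, 1, 14, 3); (105, 1, 14, 3); (109, 1, 19, 4);
      (114, 1, 19, 4); (119, 1, 24, 5); (125, 1, 5, 1)]%N.

(** Since [e <= 193/71], the test [(193/71)^a <= P^b] certifies [a <= b ln P]. *)
Definition ln_ge_check (P : BinNums.N) (a b : nat) :=
  BinNat.N.leb (powN (BN 193) a) (BinNat.N.mul (powN (BN 71) a) (powN P b)).

(** Since [492/181 <= e], the test [(a/b)^d <= (492/181)^c] certifies [d ln (a/b) <= c]. *)
Definition ln_le_check (a b c d : nat) :=
  BinNat.N.leb (BinNat.N.mul (powN (BN a) d) (powN (BN 181) c))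
               (BinNat.N.mul (powN (BN 492) c) (powN (BN b) d)).

Local Notation "a *N b" := (BinNat.N.mul a b) (at level 40, left associativity).

(** With [l = a/b] and [r = c/d], the two comparisons after the logarithm checks are
    [K <= 1.3841 l/r] and, from six primes on, [K + 1 <= l/r + 2 l/r^2], cleared of denominators. *)
Definition base_check (x K : nat) (P : BinNums.N) :=
  if (x < 7)%N || ~~ prime x then true else
  let: (a, b, c, d) := nth (0, 1, 1, 1)%N cert_table (K - 4) in
  [&& [&& 3 * b <= a, 0 < b, 0 < c & 0 < d]%N,
      ln_ge_check P a b, ln_le_check a b c d,
      BinNat.N.leb (BN 100 *N BN 100 *N BN K *N BN c *N BN b)
                   (BN 13841 *N BN a *N BN d)
    & (K < 6)%N || (8 * b <= a)%N &&
      BinNat.N.leb (BN K.+1 *N BN b *N BN c *N BN c)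
                   (BN a *N BN d *N BinNat.N.add (BN c) (BN 2 *N BN d)) ].

Lemma base_checked : scan base_check 149 0 0 (BN 1).
Proof. by vm_compute. Qed.

(** Nothing changes between primes, so the entry of the last prime serves; the descent stops at the
    prime 7. *)
Lemma base_cert x : (7 <= x < 149)%N -> exists a b c d : nat,
  [/\ [&& 3 * b <= a, 0 < b, 0 < c & 0 < d]%N,
      ln_ge_check (BN (primorial x)) a b, ln_le_check a b c d,
      (100 * 100 * ppi x * c * b <= 13841 * a * d)%N
    & (ppi x < 6)%N \/
      (8 * b <= a)%N /\ ((ppi x).+1 * b * c * c <= a * d * (c + 2 * d))%N].
Proof.
elim: x => // x IH xb; have [pp|npp] := boolP (prime x.+1); last first.
  have x7 : x != 6 by apply: contraNneq npp => ->.
  by rewrite primorialS ppiS (negbTE npp) mul1n addn0; apply: IH; lia.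
have xl : (x.+1 < 149)%N by lia.
have := scanP _ _ base_checked x.+1 xl; rewrite /base_check pp.
have -> : (x.+1 < 7)%N = false by lia.
case: (nth _ _ _) => [[[a b] c] d] /=.
move=> /and5P[h1 h2 h3 h4 h5]; exists a, b, c, d; split => //.
- by apply: lebN_of_nat; rewrite !Nnat.Nat2N.inj_mul.
- move: h5 => /orP[->|/andP[h h']]; [by left|right; split => //].
  by apply: lebN_of_nat; rewrite !(Nnat.Nat2N.inj_mul, Nnat.Nat2N.inj_add).
Qed.

(** * Bounds on Chebyshev's function theta *)

Section Theta.
Variable R : realType.

Definition theta (x : nat) : R := ln (primorial x)%:R.

Lemma ln_ge_cert (m a b : nat) : (0 < m)%N -> ln_ge_check (BN m) a b ->
  a%:R <= b%:R * ln (m%:R : R).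
Proof.
move=> m0; rewrite /ln_ge_check !powN_of_nat -Nnat.Nat2N.inj_mul => /lebN_of_nat le.
have m0' : 0 < m%:R :> R by rewrite ltr0n.
rewrite mulr_natl -lnXn // -[leLHS](@expRK R) ler_ln ?posrE ?expR_gt0 ?exprn_gt0 //.
rewrite -[a%:R]mulr1 expRM_natl.
apply: (@le_trans _ _ ((193%:R / 71%:R) ^+ a)).
  apply: lerXn2r; last exact: expR1_le.
    by rewrite nnegrE expR_ge0.
  by rewrite nnegrE; exact: divr_ge0 (ler0n _ _) (ler0n _ _).
rewrite expr_div_n ler_pdivrMr ?exprn_gt0 // mulrC.
by rewrite -!natrX -natrM ler_nat.
Qed.

Lemma ln_le_cert (a b c d : nat) : (0 < a)%N -> (0 < b)%N ->
  ln_le_check a b c d -> d%:R * ln (a%:R / b%:R : R) <= c%:R.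
Proof.
move=> a0 b0; rewrite /ln_le_check !powN_of_nat -!Nnat.Nat2N.inj_mul.
move=> /lebN_of_nat le; have a0' : 0 < a%:R :> R by rewrite ltr0n.
have b0' : 0 < b%:R :> R by rewrite ltr0n.
rewrite mulr_natl -lnXn ?divr_gt0 // -[leRHS](@expRK R).
rewrite ler_ln ?posrE ?expR_gt0 ?exprn_gt0 ?divr_gt0 //.
rewrite -[c%:R]mulr1 expRM_natl.
apply: (@le_trans _ _ ((492%:R / 181%:R) ^+ c)); last first.
  apply: lerXn2r; last exact: expR1_ge.
    by rewrite nnegrE; exact: divr_ge0 (ler0n _ _) (ler0n _ _).
  by rewrite nnegrE expR_ge0.
rewrite !expr_div_n ler_pdivlMr ?exprn_gt0 // mulrAC ler_pdivrMr ?exprn_gt0 //.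
by rewrite -!natrX -!natrM ler_nat.
Qed.

Lemma ln_ge_log2 (m k : nat) : (0 < m)%N ->
  BinNat.N.leb (BN k) (BinNat.N.log2 (BN m)) -> k%:R * ln 2%:R <= ln m%:R :> R.
Proof.
move=> m0 le; rewrite mulr_natl -lnXn // ler_ln ?posrE ?exprn_gt0 ?ltr0n //.
have [lo _] := log2N_bounds _ m0; rewrite -natrX ler_nat.
by apply: leq_trans lo; rewrite leq_exp2l //; lia.
Qed.

Lemma thetaS x : prime x.+1 -> theta x.+1 = theta x + ln x.+1%:R.
Proof.
move=> pp; rewrite /theta primorialS pp natrM lnM ?posrE ?ltr0n ?primorial_gt0 //.
exact: addrC.
Qed.

Lemma le_theta x y : (x <= y)%N -> theta x <= theta y.
Proof.
by move=> xy; rewrite ler_ln ?posrE ?ltr0n ?primorial_gt0 // ler_nat leq_primorial.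
Qed.

Lemma ln2_ge : 9%:R / 13%:R <= ln 2%:R :> R.
Proof.
have : 9%:R <= 13%:R * ln 2%:R :> R by apply: ln_ge_cert; last by vm_compute.
by lra.
Qed.

Lemma ln2_le : ln 2%:R <= 61%:R / 88%:R :> R.
Proof.
have : 88%:R * ln (2%:R / 1%:R) <= 61%:R :> R by apply: ln_le_cert; last by vm_compute.
by rewrite divr1; lra.
Qed.

Lemma theta149_ge : 130%:R <= theta 149.
Proof.
pose f (x K : nat) P := if (x < 149)%N then true else ln_ge_check P 130 1.
have sc : scan f 150 0 0 (BN 1) by vm_compute.
have := scanP _ _ sc 149 (leqnn _); rewrite /f ltnn.
by move/(ln_ge_cert _ _ _ (primorial_gt0 149)); rewrite mul1r.
Qed.

Lemma theta800_ge_log2 : 1094%:R * ln 2%:R <= theta 800.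
Proof.
pose f (x K : nat) P :=
  if (x < 800)%N then true else BinNat.N.leb (BN 1094) (BinNat.N.log2 P).
have sc : scan f 801 0 0 (BN 1) by vm_compute.
apply: ln_ge_log2; first exact: primorial_gt0.
by have := scanP _ _ sc 800 (leqnn _); rewrite /f ltnn.
Qed.

Lemma theta800_ge : 757%:R <= theta 800.
Proof.
have := theta800_ge_log2; move: (theta 800) => T; have := ln2_ge.
by move: (ln 2%:R) => l; lra.
Qed.

Lemma sqrt_floor_ex (n : nat) : exists s, (s ^ 2 <= n < s.+1 ^ 2)%N.
Proof.
elim: n => [|n [s /andP[lo hi]]]; first by exists 0%N.
have [lt|ge] := ltnP n.+1 (s.+1 ^ 2)%N; first by exists s; rewrite lt leqW.
exists s.+1; rewrite ge /=; apply: leq_ltn_trans hi _.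
by rewrite ltn_exp2r.
Qed.

(** The logarithm of [primorial_geq] gives [theta(2m) >= 2m ln 2 - t ln(2m)] with
    [(t-1)^2 <= 2m < t^2]. As [ln 2 > 1/e], the main term exceeds [2m / e] by a multiple of [t^2]
    that absorbs the error. *)
Lemma theta_ge_large x : (800 <= x)%N -> x.+1%:R <= expR 1 * theta x.
Proof.
move=> x800; pose m := x./2.
have m0 : (0 < m)%N by rewrite /m; lia.
have m400 : (400 <= m)%N by rewrite /m; lia.
have xm : (x <= m.*2.+1)%N by rewrite /m; lia.
have [s /andP[lo hi]] := sqrt_floor_ex m.*2.
have := primorial_geq _ _ m0 hi; set t := s.+1 in hi *.
(* Here [28^2 = 784 < 800 <= 2m < t^2]. *)
have t29 : (29 <= t)%N by rewrite leqNgt; apply/negP => t28; nia.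
rewrite -(ler_nat R) => le.
have tl : (t%:R - 1) ^+ 2 <= m.*2%:R :> R.
  by rewrite /t -natr1 addrK -natrX ler_nat.
have th : theta m.*2 <= theta x by apply: le_theta; rewrite /m; lia.
have lnm : ln m.*2%:R <= 2%:R * ln t%:R :> R.
  rewrite mulr_natl -lnXn ?ltr0n // ler_ln ?posrE ?ltr0n ?exprn_gt0 ?ltr0n //.
    by rewrite -natrX ler_nat ltnW.
  by lia.
(* The tangent at [32 = 2^5], close to the least value 29 of [t], makes the error term a quadratic
   polynomial in [t]. *)
have lnt : ln t%:R <= t%:R / 32%:R - 1 + 5%:R * ln 2%:R :> R.
  have := @ln_sub_le R 32%:R t%:R; rewrite !ltr0n => /(_ isT isT).
  rewrite -[32%N]/(2 ^ 5)%N natrX lnXn // -mulr_natl -natrX => ?.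
  have : (t%:R - 32%:R) / 32%:R = t%:R / 32%:R - 1 :> R by field.
  by lra.
have {}le : m.*2%:R * ln 2%:R <= t%:R * ln m.*2%:R + theta m.*2 :> R.
  have n0 : 0 < m.*2%:R :> R by rewrite ltr0n double_gt0.
  have P0 : 0 < (primorial m.*2)%:R :> R by rewrite ltr0n primorial_gt0.
  rewrite !mulr_natl -!lnXn // -lnM ?posrE ?exprn_gt0 //.
  by rewrite ler_ln ?posrE ?mulr_gt0 ?exprn_gt0 // -!natrX -natrM.
have xm' : x.+1%:R <= m.*2%:R + 2%:R :> R by rewrite -natrD ler_nat; lia.
have t29' : 29%:R <= t%:R :> R by rewrite ler_nat.
move: (theta x) (theta m.*2) th le => T1 T2 th le.
have := expR1_ge R; have := ln2_ge; have := ln2_le; move: le lnt.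
move: (expR 1) (ln 2%:R) => E l2 le lnt h1 h2 h3.
set M : R := m.*2%:R in tl lnm xm' le *; set u : R := t%:R in tl lnm lnt le t29' *.
have lM : u * ln M <= u * (u / 16%:R - 2%:R + 10%:R * (61%:R / 88%:R)).
  by rewrite ler_pM2l; lra.
have M2 : (9%:R / 13%:R - 181%:R / 492%:R) * (u - 1) ^+ 2 <=
          (9%:R / 13%:R - 181%:R / 492%:R) * M.
  by rewrite ler_pM2l; [exact: tl | lra].
have l2M : 9%:R / 13%:R * M <= M * l2 by rewrite mulrC ler_pM2l; nra.
have T2b : 181%:R / 492%:R * (M + 2%:R) <= T2 by nra.
have T0 : 0 <= T1 by nra.
have := ler_wpM2r T0 h3.
by lra.
Qed.

Lemma theta_ge_mid x : (29 <= x <= 800)%N -> x.+1%:R * ln 2%:R <= theta x.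
Proof.
move=> xb; have P0 : 0 < (primorial x)%:R :> R by rewrite ltr0n primorial_gt0.
rewrite mulr_natl -lnXn // ler_ln ?posrE ?exprn_gt0 // -natrX ler_nat.
exact: primorial_ge_mid.
Qed.

(** This supplies [p <= e theta(p - 1)] for the inductions over primes. *)
Lemma theta_ge x : (5 <= x)%N -> x.+1%:R <= expR 1 * theta x.
Proof.
move=> x5; have [x800|x800] := leqP 800 x; first exact: theta_ge_large.
have P0 : 0 < (primorial x)%:R :> R by rewrite ltr0n primorial_gt0.
have H : 5%:R / 9%:R * x.+1%:R * ln 2%:R <= theta x.
  have [x29|x29] := leqP 29 x.
    have xb : (29 <= x <= 800)%N by rewrite x29 ltnW.
    have := theta_ge_mid _ xb.
    have := ln2_ge; have := ler0n R x.+1; nra.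
  have : (5 * x.+1)%:R * ln 2%:R <= 9%:R * theta x.
    rewrite !mulr_natl -!lnXn // ler_ln ?posrE ?exprn_gt0 // -!natrX ler_nat.
    by rewrite primorial_ge_small // x5.
  by rewrite natrM; lra.
have T0 : 0 <= theta x by have := ln2_ge; have := ler0n R x.+1; nra.
have := ler_wpM2r T0 (expR1_ge R).
by have := ln2_ge; have := ler0n R x.+1; nra.
Qed.

Lemma theta_le_mid x : (29 <= x <= 800)%N -> theta x <= 3%:R / 2%:R * ln 2%:R * x%:R.
Proof.
move=> xb; have P0 : 0 < (primorial x)%:R :> R by rewrite ltr0n primorial_gt0.
have : 2%:R * theta x <= (3 * x)%:R * ln 2%:R.
  rewrite !mulr_natl -!lnXn // ler_ln ?posrE ?exprn_gt0 // -!natrX ler_nat.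
  exact: primorial_le_mid.
by rewrite natrM; lra.
Qed.

Lemma theta_le x : theta x <= 2%:R * ln 2%:R * x%:R.
Proof.
have P0 : 0 < (primorial x)%:R :> R by rewrite ltr0n primorial_gt0.
have : theta x <= (2 * x)%:R * ln 2%:R.
  rewrite !mulr_natl -!lnXn // ler_ln ?posrE ?exprn_gt0 // -!natrX ler_nat.
  by rewrite expnM primorial_leq_exp4.
by rewrite natrM; lra.
Qed.

End Theta.

(** * The prime count compared with theta *)

Section Estimates.
Variable R : realType.
Implicit Types L y a : R.

Local Notation th := (@theta R).
Local Notation c := (13841%:R / 10000%:R : R).

Lemma robin_const_ge : 138%:R / 100%:R <= c.
Proof. lra. Qed.

Lemma primorial5 : primorial 5 = 30%N.
Proof. by rewrite !primorialS /primorial big_nil. Qed.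

Lemma theta_ge3 x : (5 <= x)%N -> 3%:R <= th x.
Proof.
move=> x5; apply: le_trans (le_theta R _ _ x5).
have : 3%:R <= 1%:R * ln 30%:R :> R by apply: ln_ge_cert => //; vm_compute.
by rewrite mul1r /theta primorial5.
Qed.

(* Squaring away the logarithm: with [s] the square root of [L] and
   [ln s >= 1 - 1/s], it suffices that [s^3 < 8 s - 8]. *)
Lemma div_ln_lt4 L : 16%:R / 10%:R <= L -> L <= 36%:R / 10%:R -> L / ln L < 4%:R.
Proof.
move=> lo hi; pose s := Num.sqrt L.
have s0 : 0 < s by rewrite sqrtr_gt0; lra.
have sE : s ^+ 2 = L by rewrite sqr_sqrtr //; lra.
have slo : 126%:R / 100%:R <= s by nra.
have shi : s <= 19%:R / 10%:R by nra.
have := ln_sub_le R s 1 s0 ltr01; rewrite ln1 sub0r ler_pdivlMr // => ls.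
rewrite ltr_pdivrMr; last by apply: ln_gt0; lra.
by rewrite -{2}sE lnXn // -mulr_natl; nra.
Qed.

Lemma ln30_le : ln 30%:R <= 36%:R / 10%:R :> R.
Proof.
have : 5%:R * ln (30%:R / 1%:R) <= 18%:R :> R by apply: ln_le_cert => //; vm_compute.
by rewrite divr1; lra.
Qed.

(** The start is [theta 5 = ln 30] with three primes; at each further prime the left side grows by
    at most 1, by [div_ln_add_le]. *)
Lemma div_ln_theta_lt x : (5 <= x)%N -> th x / ln (th x) < (ppi x)%:R + 1.
Proof.
elim: x => // x IH; rewrite leq_eqVlt => /orP[/eqP <-|x5].
  rewrite (_ : ppi 5 = 3) // (_ : 3%:R + 1 = 4%:R :> R); last by ring.
  apply: div_ln_lt4; first by have := theta_ge3 5 isT; lra.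
  by rewrite /theta primorial5 ln30_le.
have {}IH := IH x5; have [pp|npp] := boolP (prime x.+1); last first.
  by rewrite /theta primorialS ppiS (negbTE npp) mul1n addn0.
have L3 := theta_ge3 x x5.
rewrite ppiS pp addn1 thetaS // -[(ppi x).+1%:R]natr1.
apply: le_lt_trans (_ : th x / ln (th x) + 1 < _); last by lra.
apply: div_ln_add_le; first by lra.
  by apply: ln_gt0; rewrite ltr1n; lia.
have e0 := expR_gt0 (1 : R).
rewrite -[X in X + _](@expRK R) -lnM ?posrE //; last by lra.
by rewrite ler_ln ?posrE ?ltr0n ?theta_ge // mulr_gt0 //; lra.
Qed.

(** The [+ 1] in the second bound reflects [kseq n = ppi x + 1]. Six primes is where theta first
    passes 8, the threshold of [div_ln_sqr_le]. *)
Definition upper_bounds x :=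
  (ppi x)%:R <= c * (th x / ln (th x)) /\
  ((6 <= ppi x)%N -> 8%:R <= th x /\
   (ppi x)%:R + 1 <= th x / ln (th x) + 2%:R * (th x / ln (th x) ^+ 2)).

(** Monotonicity replaces [th x] by its lower bound [l], and [ln l] is then replaced by its upper
    bound [r]; what remains is the integer certificate. *)
Lemma upper_bounds_base x : (7 <= x < 149)%N -> upper_bounds x.
Proof.
move=> xb; have [a [b [c' [d [/and4P[ab b0 c0 d0] h1 h2 h3 h4]]]]] := base_cert _ xb.
have e3 := expR1_le R; have e0 := expR_gt0 (1 : R).
have b0' : 0 < b%:R :> R by rewrite ltr0n.
have c0' : 0 < c'%:R :> R by rewrite ltr0n.
have d0' : 0 < d%:R :> R by rewrite ltr0n.
have a0 : (0 < a)%N by lia.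
have a0' : 0 < a%:R :> R by rewrite ltr0n.
have := ln_ge_cert R _ _ _ (primorial_gt0 x) h1; rewrite -/(th x) => hl.
have := ln_le_cert R _ _ _ _ a0 b0 h2; set l := a%:R / b%:R => hr.
have lE : l * b%:R = a%:R by rewrite divfK // gt_eqF.
have l3 : 3%:R <= l by rewrite ler_pdivlMr // -natrM ler_nat.
have lth : l <= th x by rewrite ler_pdivrMr // mulrC.
have el : expR 1 <= l by lra.
have ll := ln_ge1 R _ el.
pose r : R := c'%:R / d%:R.
have rE : r * d%:R = c'%:R by rewrite divfK // gt_eqF.
have r0 : 0 < r by rewrite divr_gt0.
have lr : ln l <= r by rewrite ler_pdivlMr // mulrC.
have F1 : l / r <= l / ln l by rewrite ler_pM2l ?lef_pV2 ?posrE //; lra.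
split.
  have := div_ln_le R _ _ el lth => F2.
  have : (ppi x)%:R <= c * (l / r).
    have -> : c * (l / r) = 13841%:R * a%:R * d%:R / (10000%:R * (b%:R * c'%:R)).
      by rewrite /l /r; field; rewrite !gt_eqF.
    rewrite ler_pdivlMr ?mulr_gt0 //; move: h3; rewrite -(ler_nat R).
    rewrite (natrM _ (100 * 100 * ppi x * c')%N b) (natrM _ (100 * 100 * ppi x)%N c').
    rewrite (natrM _ (100 * 100)%N (ppi x)) (natrM _ 100 100).
    by rewrite (natrM _ (13841 * a)%N d) (natrM _ 13841 a); lra.
  by have := robin_const_ge; nra.
move=> K6; case: h4 => [|[ab8]]; first by rewrite ltnNge K6.
rewrite -(ler_nat R) => h4.
have l8 : 8%:R <= l by rewrite ler_pdivlMr // -natrM ler_nat.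
split; first by lra.
have := div_ln_le R _ _ el lth; have := div_ln_sqr_le R _ _ l8 lth.
have G1 : l / r ^+ 2 <= l / ln l ^+ 2.
  rewrite ler_pM2l ?lef_pV2 ?posrE ?exprn_gt0 //; try lra.
  by apply: lerXn2r => //; rewrite ?nnegrE; lra.
suff : (ppi x)%:R + 1 <= l / r + 2%:R * (l / r ^+ 2) by lra.
have -> : l / r + 2%:R * (l / r ^+ 2) =
    a%:R * d%:R * (c'%:R + 2%:R * d%:R) / (b%:R * c'%:R * c'%:R).
  by rewrite /l /r; field; rewrite !gt_eqF.
rewrite ler_pdivlMr ?mulr_gt0 //; move: h4.
rewrite (natrM _ ((ppi x).+1 * b * c')%N c') (natrM _ ((ppi x).+1 * b)%N c').
rewrite (natrM _ (ppi x).+1 b) (natrM _ (a * d)%N _) (natrM _ a d) natrD (natrM _ 2 d).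
by rewrite -[(ppi x).+1%:R]natr1; lra.
Qed.

(* [b] comes from a Chebyshev bound on [theta (x + 1) / (x + 1)]. *)
Definition step_bounds (b eps y0 : R) x :=
  [/\ ln (th x.+1) <= ln x.+1%:R + b, ln x.+1%:R / th x <= eps & y0 <= ln (th x.+1)].

Lemma step_bounds_mid x : (148 <= x < 800)%N -> prime x.+1 ->
  step_bounds (5%:R / 100%:R) (5%:R / 100%:R) (97%:R / 20%:R) x.
Proof.
move=> /andP[x1 x2] pp.
have xb : (29 <= x <= 800)%N by lia.
have xbS : (29 <= x.+1 <= 800)%N by lia.
have p0 : 0 < x.+1%:R :> R by [].
have l2l := ln2_ge R; have l2u := ln2_le R.
have x5 : (5 <= x)%N by exact: leq_trans x1.
have L0 : 0 < th x by have := theta_ge3 x x5; lra.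
have L1 : 0 < th x.+1 by have := le_theta R _ _ (leqnSn x); lra.
split.
(* [3/2 ln 2 <= 3/2 * 61/88 < 1.05 <= e^0.05]. *)
- have -> : ln x.+1%:R + 5%:R / 100%:R = ln (x.+1%:R * expR (5%:R / 100%:R)) :> R.
    by rewrite lnM ?posrE ?expR_gt0 // expRK.
  rewrite ler_ln ?posrE ?mulr_gt0 ?expR_gt0 //.
  have h := theta_le_mid R _ xbS.
  apply: le_trans h _; rewrite mulrC ler_pM2l //.
  by apply: le_trans (expR_ge1Dx _); lra.
(* As [ln p / p] decreases, the ratio is at most [5.1 / (149 * 9/13) < 0.05]. *)
- have e149 : expR 1 <= 149%:R :> R by have := expR1_le R; lra.
  have le149 : 149%:R <= x.+1%:R :> R by rewrite ler_nat ltnS.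
  have := div_ln_le R _ _ e149 le149.
  have : 10%:R * ln (149%:R / 1%:R) <= 51%:R :> R by apply: ln_le_cert => //; vm_compute.
  have l149 : 0 < ln 149%:R :> R by apply: ln_gt0; rewrite ltr1n.
  have lp : 0 < ln x.+1%:R :> R by apply: ln_gt0; rewrite ltr1n ltnS (leq_trans _ x5).
  rewrite divr1 => ln149; rewrite ler_pdivrMr // mulrAC ler_pdivlMr // => h.
  have h2 := theta_ge_mid R _ xb.
  rewrite ler_pdivrMr //.
  have h3 : x.+1%:R * (9%:R / 13%:R) <= x.+1%:R * ln 2%:R :> R by rewrite ler_pM2l.
  have h4 : x.+1%:R * ln 149%:R <= x.+1%:R * (51%:R / 10%:R) :> R by rewrite ler_pM2l //; lra.
  by lra.
- have : 97%:R <= 20%:R * ln 130%:R :> R by apply: ln_ge_cert => //; vm_compute.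
  have : ln 130%:R <= ln (th x.+1) :> R; last by lra.
  have h : 130%:R <= th x.+1 by exact: le_trans (theta149_ge R) (le_theta R 149 x.+1 x1).
  by rewrite ler_ln; [exact: h | rewrite posrE ltr0n | rewrite posrE].
Qed.

Lemma step_bounds_large x : (800 <= x)%N -> prime x.+1 ->
  step_bounds (1 / 3%:R) (23%:R / 1000%:R) (33%:R / 5%:R) x.
Proof.
move=> x1 pp; have p0 : 0 < x.+1%:R :> R by [].
have l2l := ln2_ge R; have l2u := ln2_le R.
have x5 : (5 <= x)%N by exact: leq_trans x1.
have L0 : 0 < th x by have := theta_ge3 x x5; lra.
have L1 : 0 < th x.+1 by have := le_theta R _ _ (leqnSn x); lra.
split.
(* [2 ln 2 <= 122/88 <= e^(1/3)]. *)
- have : 3%:R * ln (122%:R / 88%:R) <= 1%:R :> R by apply: ln_le_cert => //; vm_compute.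
  have : ln (th x.+1) <= ln (x.+1%:R * (122%:R / 88%:R)).
    rewrite ler_ln ?posrE ?mulr_gt0 //; apply: le_trans (theta_le R _) _.
    by rewrite mulrC ler_pM2l //; lra.
  by rewrite lnM ?posrE //; lra.
- have e801 : expR 1 <= 801%:R :> R by have := expR1_le R; lra.
  have le801 : 801%:R <= x.+1%:R :> R by rewrite ler_nat ltnS.
  have := div_ln_le R _ _ e801 le801.
  have : 10%:R * ln (801%:R / 1%:R) <= 67%:R :> R by apply: ln_le_cert => //; vm_compute.
  have l801 : 0 < ln 801%:R :> R by apply: ln_gt0; rewrite ltr1n.
  have lp : 0 < ln x.+1%:R :> R by apply: ln_gt0; rewrite ltr1n ltnS (leq_trans _ x5).
  rewrite divr1 => ln801; rewrite ler_pdivrMr // mulrAC ler_pdivlMr // => h.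
  have h2 := theta_ge R x x5.
  have h3 : expR 1 * th x <= 193%:R / 71%:R * th x by rewrite ler_pM2r // expR1_le.
  rewrite ler_pdivrMr //.
  have h4 : x.+1%:R * ln 801%:R <= x.+1%:R * (67%:R / 10%:R) :> R by rewrite ler_pM2l //; lra.
  by lra.
- have : 33%:R <= 5%:R * ln 757%:R :> R by apply: ln_ge_cert => //; vm_compute.
  have : ln 757%:R <= ln (th x.+1) :> R; last by lra.
  have h := le_trans (theta800_ge R) (le_theta R _ _ (leqW x1)).
  by rewrite ler_ln; [exact: h | rewrite posrE ltr0n | rewrite posrE].
Qed.

(** With [y = ln theta(x+1)], the bounds [ln p >= y - b] and [ln p / theta(x) <= eps] reduce the
    hypotheses of both increment lemmas to polynomial inequalities in [y] alone. *)
Lemma upper_bounds_step (b eps y0 : R) x : (5 <= x)%N -> prime x.+1 ->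
    step_bounds b eps y0 x -> 1 <= y0 ->
    (forall y, y0 <= y -> [/\ 0 <= y - b, 0 <= y - 1 - eps,
      y ^+ 2 <= 138%:R / 100%:R * ((y - b) * (y - 1 - eps)),
      0 <= y ^+ 2 + y - 4%:R - eps * (y + 4%:R) &
      y ^+ 3 <= (y - b) * (y ^+ 2 + y - 4%:R - eps * (y + 4%:R))]) ->
  upper_bounds x -> (6 <= ppi x)%N -> upper_bounds x.+1.
Proof.
move=> x5 pp [yb ae yy0] y01 H [ub1 ub2] K6; have [th8 {}ub2] := ub2 K6.
have L0 : 1 < th x by lra.
have x1 : (1 < x.+1)%N by lia.
have a0 : 0 < ln x.+1%:R :> R by apply: ln_gt0; rewrite ltr1n.
have a1 : ln x.+1%:R <= 1 + ln (th x).
  have e0 := expR_gt0 (1 : R).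
  rewrite -[X in X + _](@expRK R) -lnM ?posrE //; last by lra.
  by rewrite ler_ln ?posrE ?ltr0n ?theta_ge // mulr_gt0 //; lra.
have [h1 h2 h3 h4 h5] := H _ yy0.
rewrite /upper_bounds; move: yb yy0 h1 h2 h3 h4 h5; rewrite ppiS pp addn1 thetaS //.
move: (th x) (ln x.+1%:R) L0 a0 a1 ae ub1 ub2 th8 => L a L0 a0 a1 ae ub1 ub2 th8.
set y := ln (L + a) => yb yy0 h1 h2 h3 h4 h5; rewrite -[(ppi x).+1%:R]natr1.
split.
  apply: le_trans (_ : c * (L / ln L) + 1 <= _); first by lra.
  apply: div_ln_add_ge => //; first by have := robin_const_ge; lra.
  rewrite -/y; apply: le_trans h3 _.
  have g1 : (y - b) * (y - 1 - eps) <= a * (y - 1 - a / L).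
    by apply: ler_pM => //; lra.
  by apply: ler_pM => //; [exact: mulr_ge0 | exact: robin_const_ge].
move=> _; split; first by lra.
apply: le_trans (_ : L / ln L + 2%:R * (L / ln L ^+ 2) + 1 <= _); first by lra.
apply: div_ln_sqr_add_ge => //; first by rewrite -/y; lra.
rewrite -/y; apply: le_trans h5 _; apply: ler_pM => //; first by lra.
by rewrite lerD2l lerN2 ler_pM2r //; lra.
Qed.

Lemma ppi_ge6 x : (13 <= x)%N -> (6 <= ppi x)%N.
Proof.
by move=> x13; exact: leq_trans (leq_ppi 13 x x13).
Qed.

(** Certificates reach 148 and induction takes over. From 800 on only the weaker bound
    [theta(x) <= 2 x ln 2] is available, and the larger [y0] makes up for the larger [b]. *)
Lemma upper_boundsP x : (7 <= x)%N -> upper_bounds x.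
Proof.
elim: x => // x IH x7; have [xs|xl] := ltnP x.+1 149.
  by apply: upper_bounds_base; rewrite x7.
have x5 : (5 <= x)%N by lia.
have x13 : (13 <= x)%N by lia.
have {}IH : upper_bounds x by apply: IH; lia.
have [pp|npp] := boolP (prime x.+1); last first.
  by rewrite /upper_bounds /theta primorialS ppiS (negbTE npp) mul1n addn0.
have K6 := ppi_ge6 x x13.
have [x8|x8] := ltnP x 800.
  have xb : (148 <= x < 800)%N by rewrite x8 andbT.
  apply: upper_bounds_step x5 pp (step_bounds_mid _ xb pp) _ _ IH K6; first by lra.
  by move=> y hy; split; nra.
apply: upper_bounds_step x5 pp (step_bounds_large _ x8 pp) _ _ IH K6; first by lra.
by move=> y hy; split; nra.
Qed.

End Estimates.

(** * Transfer from primorials to every [n] *)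

Section KseqBounds.
Variables (R : realType) (n : nat).

Let L : R := ln n%:R.

Let L_gt1 : (3 <= n)%N -> 1 < L.
Proof.
move=> n3; have : 21%:R <= 20%:R * ln 3%:R :> R by apply: ln_ge_cert => //; vm_compute.
have : ln 3%:R <= L; last by lra.
by rewrite ler_ln ?posrE ?ltr0n ?ler_nat //; exact: leq_trans n3.
Qed.

Let theta_bounds x : (primorial x <= n < primorial x.+1)%N ->
  theta R x <= L < theta R x.+1.
Proof.
move=> /andP[lo hi].
have P0 y : 0 < (primorial y)%:R :> R by rewrite ltr0n primorial_gt0.
have n0 : 0 < n%:R :> R by rewrite ltr0n; exact: leq_trans (primorial_gt0 x) lo.
by rewrite ler_ln ?ltr_ln ?posrE // ler_nat ltr_nat lo.
Qed.

Lemma kseq_robin_bound : (3 <= n)%N ->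
  (kseq n)%:R <= 13841%:R / 10000%:R * (L / ln L) + 1.
Proof.
move=> n3; have n1 : (1 < n)%N by exact: ltnW.
have [x [-> lo hi]] := kseq_ppi _ n1; rewrite -natr1 lerD2r.
have [xlo _] : theta R x <= L /\ L < theta R x.+1.
  by apply/andP/theta_bounds; rewrite lo hi.
have c138 := robin_const_ge R; have L1 := L_gt1 n3.
have [x7|x7] := leqP 7 x.
  have [ub _] := upper_boundsP R x x7; apply: le_trans ub _.
  have th3 : 3%:R <= theta R x by apply: theta_ge3; exact: leq_trans x7.
  rewrite ler_pM2l; last by lra.
  by apply: div_ln_le => //; have := expR1_le R; lra.
(* At most three primes lie below 7, and [1.38 * 2.7 > 3]. *)
have K3 : (ppi x)%:R <= 3%:R :> R by rewrite ler_nat; exact: (leq_ppi x 6).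
by have := div_ln_ge R _ L1; nra.
Qed.

Lemma kseq_second_order_bound : (3 <= n)%N ->
  (kseq n)%:R <= L / ln L + 2%:R * (L / ln L ^+ 2).
Proof.
move=> n3; have n1 : (1 < n)%N by exact: ltnW.
have [x [-> lo hi]] := kseq_ppi _ n1; rewrite -natr1.
have [xlo _] : theta R x <= L /\ L < theta R x.+1.
  by apply/andP/theta_bounds; rewrite lo hi.
have L1 := L_gt1 n3.
have [K6|K6] := leqP 6 (ppi x).
  have x7 : (7 <= x)%N.
    rewrite leqNgt; apply: contraL K6 => x6.
    by rewrite -ltnNge ltnS (leq_trans (leq_ppi x 6 x6)).
  have [_ /(_ K6)[th8 ub]] := upper_boundsP R x x7; apply: le_trans ub _.
  rewrite lerD //.
    by apply: div_ln_le => //; have := expR1_le R; lra.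
  by rewrite ler_pM2l //; apply: div_ln_sqr_le.
(* The two minima suffice here: [2.7 + 2 * 1.8 > 5 + 1]. *)
have K5 : (ppi x)%:R <= 5%:R :> R by rewrite ler_nat.
by have := div_ln_ge R _ L1; have := div_ln_sqr_ge R _ L1; lra.
Qed.

(** Here the upper end [L < theta(x+1)] matters, with [ppi x.+1 <= ppi x + 1 = kseq n]. *)
Lemma kseq_lower_bound : (6 <= n)%N -> L / ln L < (kseq n)%:R + 1.
Proof.
move=> n6; have n1 : (1 < n)%N by exact: leq_trans n6.
have [x [kE lo hi]] := kseq_ppi _ n1.
have [xlo xhi] : theta R x <= L /\ L < theta R x.+1.
  by apply/andP/theta_bounds; rewrite lo hi.
have [x5|x5] := leqP 5 x.
  have th3 := theta_ge3 R x x5; have e3 := expR1_le R.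
  have th1 := div_ln_theta_lt R x.+1 (leqW x5).
  apply: le_lt_trans (_ : _ <= theta R x.+1 / ln (theta R x.+1)) _.
    by apply: div_ln_le; lra.
  apply: lt_le_trans th1 _; rewrite kE ppiS lerD2r ler_nat.
  by case: prime; rewrite ?addn1 ?addn0.
(* Now [6 <= n < 30], and [omega 6 = 2] gives the bound on [kseq n]. *)
have k3 : 3%:R <= (kseq n)%:R :> R by rewrite ler_nat (kseq_omega_ltn _ 6).
suff : L / ln L < 4%:R by lra.
apply: div_ln_lt4.
  have : 8%:R <= 5%:R * ln 6%:R :> R by apply: ln_ge_cert => //; vm_compute.
  have : ln 6%:R <= L; last by lra.
  by rewrite ler_ln ?posrE ?ltr0n ?ler_nat //; exact: leq_trans n6.
apply: le_trans (ln30_le R).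
rewrite ler_ln ?posrE ?ltr0n ?ler_nat //; last exact: ltnW.
by rewrite -primorial5 (leq_trans (ltnW hi)) // leq_primorial.
Qed.

Lemma kseq_lower_bound_weak : (3 <= n)%N ->
  L / ln L <= (kseq n)%:R + 2%:R * (L / ln L ^+ 2).
Proof.
move=> n3; have L1 := L_gt1 n3; have G := div_ln_sqr_ge R _ L1.
have [n6|n6] := leqP 6 n; first by have := kseq_lower_bound n6; lra.
(* For [n < 6], [ln L <= 2] makes the second-order term alone at least [L / ln L]. *)
have l0 : 0 < ln L by exact: ln_gt0.
have L0 : 0 < L by lra.
have L3 : L <= 3%:R.
  have : 1%:R * ln (6%:R / 1%:R) <= 2%:R :> R by apply: ln_le_cert => //; vm_compute.
  rewrite divr1 mul1r; have : L <= ln 6%:R; last by lra.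
  by rewrite ler_ln ?posrE ?ltr0n ?ler_nat 1?ltnW //; lia.
have l2 : ln L <= 2%:R by have := ln_le_sub1 R _ L0; lra.
have := ler0n R (kseq n).
suff : L / ln L <= 2%:R * (L / ln L ^+ 2) by lra.
have -> : 2%:R * (L / ln L ^+ 2) = L * 2%:R / ln L / ln L by field; lra.
rewrite ler_pdivlMr // [leLHS]mulrAC ler_pM2r ?invr_gt0 //.
by rewrite ler_pM2l.
Qed.

End KseqBounds.

Theorem theorem4 (R : realType) (n : nat) : (1 <= n)%N ->
  [/\ mult1 n = (n - kseq n)%N,
      (3 <= n)%N ->
        (n%:R - (Num.floor ((13841%:R / 10000%:R) * ln (n%:R : R) / ln (ln (n%:R : R))))%:~R - 1
           <= (mult1 n)%:R :> R),
      (6 <= n)%N ->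
        ((mult1 n)%:R <= n%:R - (Num.floor (ln (n%:R : R) / ln (ln (n%:R : R))))%:~R :> R)
    & (3 <= n)%N ->
        `| (mult1 n)%:R - n%:R + ln (n%:R : R) / ln (ln (n%:R : R)) |
           <= 2 * ln (n%:R : R) / (ln (ln (n%:R : R))) ^+ 2 :> R].
Proof.
move=> n0; have mE := mult1E n n0.
have mR : (mult1 n)%:R = n%:R - (kseq n)%:R :> R by rewrite mE natrB // kseq_leq.
split=> // n3; rewrite ?mR.
- have n1 : (1 < n)%N by exact: ltnW.
  (* [kseq n - 1 = omega m] is an integer, so its real upper bound passes to the floor. *)
  have [m [_ _ kE]] := kseq_omega_ex _ n1; have := kseq_robin_bound R _ n3.
  rewrite kE -natr1 lerD2r mulrA -[(omega m)%:R]/((Posz (omega m))%:~R).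
  rewrite -floor_ge_int -(ler_int R) => h.
  by have : (Posz (omega m))%:~R = (omega m)%:R :> R by []; lra.
(* The integer [kseq n + 1] is strictly above the quotient, so the floor is at most [kseq n]. *)
- have := kseq_lower_bound R _ n3.
  rewrite natr1 -[(kseq n).+1%:R]/((Posz (kseq n).+1)%:~R) -floor_lt_int => h.
  rewrite lerD2l lerN2 -[leRHS]/((Posz (kseq n))%:~R) ler_int.
  by move: h; set k := Num.floor _; lia.
- have := kseq_second_order_bound R _ n3; have := kseq_lower_bound_weak R _ n3.
  rewrite ler_norml -mulrA => *; apply/andP; split; lra.
Qed.
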